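(* Let $0<T\in\mathcal{L}^{1,\infty}$ be such that $\mathrm{Tr}_\omega(T)>0$ for all $\omega\in DL_2$. Let $\omega\in\mathcal{L}(BL\cap DL)$, and set $\phi_\omega(A) := \mathrm{Tr}_\omega(AT)/\mathrm{Tr}_\omega(T)$ for $A\in B(H)$. Let $\{h_m\}_{m=1}^\infty$ be any complete orthonormal system of eigenvectors of $T$. Then there is a generalised limit $L_\omega$ on $\ell^\infty$ such that $$\phi_\omega(A) = L_\omega\left(\{\langle h_m, A h_m\rangle\}_{m=1}^\infty\right)\quad\text{for all } A\in B(H).$$
   Context: $H$ is a separable complex Hilbert space, $B(H)$ the bounded linear operators on $H$. For a compact operator $T$, $\mu_1(T)\ge\mu_2(T)\ge\dots$ are its singular values (with multiplicity). $\mathcal{L}^{1,\infty}$ is the set of compact $T$ with $\sup_n \log(1+n)^{-1}\sum_{j=1}^n\mu_j(T)<\infty$. $0<T$ means $T$ is a positive operator. A generalised limit is a state $L$ on $\ell^\infty$ (positive functional with $L(1)=1$) such that $\liminf_k a_k\le L(\{a_k\})\le\limsup_k a_k$ for all $\{a_k\}\ge 0$ in $\ell^\infty$. On $\ell^\infty$ define, for $j\in\mathbb{N}$, $T_j(\{a_k\}_{k=1}^\infty) = \{a_{k+j}\}_{k=1}^\infty$ and $D_j(\{a_k\}_{k=1}^\infty) = \{a_{\lceil k/j\rceil}\}_{k=1}^\infty$. $BL$ (resp. $DL$) is the set of states $\omega$ on $\ell^\infty$ with $\omega\circ T_j=\omega$ (resp. $\omega\circ D_j=\omega$) for all $j\in\mathbb{N}$.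 For $0<T\in\mathcal{L}^{1,\infty}$ let $\gamma(T) := \{\log(1+k)^{-1}\sum_{j=1}^k\mu_j(T)\}_{k=1}^\infty\in\ell^\infty$. $DL_2$ is the set of generalised limits $\omega$ on $\ell^\infty$ with $\omega(D_2(\gamma(T)))=\omega(\gamma(T))$ for all $0<T\in\mathcal{L}^{1,\infty}$. For $\omega\in DL_2$, $\mathrm{Tr}_\omega(T):=\omega(\gamma(T))$, $0<T\in\mathcal{L}^{1,\infty}$, defines a tracial weight, and $\mathrm{Tr}_\omega$ also denotes its linear extension to $\mathcal{L}^{1,\infty}$. Define $E:L^\infty([0,\infty))\to\ell^\infty$ by $E_k(f)=\int_{k-1}^k f(t)\,dt$; $L^{-1}:L^\infty([1,\infty))\to L^\infty([0,\infty))$ by $L^{-1}(g)(t)=g(e^t)$; $p:\ell^\infty\to L^\infty([1,\infty))$ by $p(\{a_k\})(t)=\sum_{k=1}^\infty a_k\chi_{[k,k+1)}(t)$; and $\mathcal{L}:(\ell^\infty)^*\to(\ell^\infty)^*$ by $\mathcal{L}(\xi):=\xi\circ E\circ L^{-1}\circ p$. $\mathcal{L}(BL\cap DL)$ is the image of $BL\cap DL$ under $\mathcal{L}$; it is contained in $DL_2$. *)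

(* Defs.v *)
From HB Require Import structures.
From mathcomp Require Import all_boot all_order all_algebra.
From mathcomp Require Import complex.
From mathcomp Require Import all_classical all_reals all_analysis.
From mathcomp Require Import ring lra zify.
Set Implicit Arguments.
Unset Strict Implicit.
Unset Printing Implicit Defensive.
Import Order.TTheory GRing.Theory Num.Theory numFieldNormedType.Exports.
Local Open Scope classical_set_scope.
Local Open Scope ring_scope.
Local Open Scope complex_scope.

(* The inner product is linear in its second argument.  Positive definiteness
   follows from [inner_norm]; completeness is that of the normed module. *)
HB.mixin Record CompleteNormedModule_isHilbert (R : realType) H
    of CompleteNormedModule R[i] H := {
  inner : H -> H -> R[i];
  inner_conj : forall x y, inner y x = Num.conj (inner x y);
  inner_linear : forall x, scalar (inner x);
  inner_norm : forall x, inner x x = `|x| ^+ 2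
}.

#[short(type="hilbertType")]
HB.structure Definition Hilbert (R : realType) :=
  { H of CompleteNormedModule R[i] H & CompleteNormedModule_isHilbert R H }.

Section Hilbert_geometry.
Context (R : realType) (H : hilbertType R).

Definition separable_space : Prop := exists2 D : set H, countable D & dense D.

Definition orthonormal_system (I : eqType) (e : I -> H) : Prop :=
  forall i j, inner (e i) (e j) = (i == j)%:R.

Definition complete_system (I : Type) (e : I -> H) : Prop :=
  forall x, (forall i, inner (e i) x = 0) -> x = 0.

Lemma inner0r (x : H) : inner x 0 = 0.
Proof. by have := inner_linear x (-1) 0 0; rewrite scaler0 addr0 mulN1r addNr. Qed.

Lemma innerDr (x y z : H) : inner x (y + z) = inner x y + inner x z.
Proof. by rewrite -{1}[y]scale1r inner_linear mul1r. Qed.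

Lemma innerZr (x y : H) (c : R[i]) : inner x (c *: y) = c * inner x y.
Proof. by rewrite -[c *: y]addr0 inner_linear inner0r addr0. Qed.

Lemma innerNr (x y : H) : inner x (- y) = - inner x y.
Proof. by rewrite -scaleN1r innerZr mulN1r. Qed.

Lemma innerDl (x y z : H) : inner (x + y) z = inner x z + inner y z.
Proof. by rewrite inner_conj innerDr rmorphD /= -!inner_conj. Qed.

Lemma innerZl (x y : H) (c : R[i]) :
  inner (c *: x) y = Num.conj c * inner x y.
Proof. by rewrite inner_conj innerZr rmorphM /= -inner_conj. Qed.

Lemma innerNl (x y : H) : inner (- x) y = - inner x y.
Proof. by rewrite inner_conj innerNr rmorphN /= -inner_conj. Qed.

Lemma orthonormal_system_norm (I : eqType) (e : I -> H) :
  orthonormal_system e -> forall i, `|e i| = 1.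
Proof.
move=> oe i; have := oe i i; rewrite eqxx inner_norm => /eqP.
by rewrite sqrf_eq1 => /orP[/eqP//|/eqP n1]; have := normr_ge0 (e i);
  rewrite n1 oppr_ge0 lt_geF // ltr01.
Qed.

Lemma inner_unit_le (e x : H) : `|e| = 1 -> `|inner e x| <= `|x|.
Proof.
move=> e1; rewrite -ler_sqr ?nnegrE ?normr_ge0// -subr_ge0.
have -> : `|x| ^+ 2 - `|inner e x| ^+ 2 = `|x - inner e x *: e| ^+ 2.
  rewrite -!inner_norm normCK innerDl !innerDr !innerNr !innerNl !innerZr !innerZl.
  by rewrite (inner_norm e) e1 [inner x e]inner_conj; ring.
by rewrite exprn_ge0.
Qed.

End Hilbert_geometry.

Section bounded_operators.
Context (R : realType) (H : hilbertType R).

Definition bounded_operator : {pred H -> H} :=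
  [pred A : H -> H | `[< linear A /\
    exists M : R, forall x, `|A x| <= M%:C * `|x| >]].

Lemma bounded_operator_submod_closed : submod_closed bounded_operator.
Proof.
split=> [|c A B].
  rewrite inE /=; split=> [k x y|]; first by rewrite /= scaler0 addr0.
  by exists 0 => x; rewrite normr0 mul0r.
rewrite !inE /= => -[lA [M MA]] [lB [N NB]]; split.
  move=> k x y; rewrite /= !fctE lA lB !scalerDr !scalerA mulrC.
  by rewrite -!addrA; congr (_ + _); rewrite addrCA.
have [m hm] : exists m : R, `|c| = m%:C by exists (complex.Re `|c|); rewrite RRe_real.
exists (m * M + N) => x; rewrite /= !fctE (le_trans (ler_normD _ _))//.
rewrite normrZ rmorphD rmorphM /= -hm mulrDl -mulrA lerD//.
by rewrite ler_wpM2l.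
Qed.

HB.instance Definition _ :=
  GRing.isSubmodClosed.Build R[i] (H -> H) bounded_operator
    bounded_operator_submod_closed.

Record bop := Bop { bop_fun :> H -> H ; bopP : bop_fun \in bounded_operator }.

HB.instance Definition _ := [isSub for bop_fun].
HB.instance Definition _ := [Choice of bop by <:].
HB.instance Definition _ := [SubChoice_isSubLmodule of bop by <:].

Lemma bop_linear (A : bop) : linear A.
Proof. by have := bopP A; rewrite inE /= => -[]. Qed.

HB.instance Definition _ (A : bop) := GRing.isLinear.Build _ _ _ _ A (@bop_linear A).

Lemma bop_bounded (A : bop) : exists M : R, forall x, `|A x| <= M%:C * `|x|.
Proof. by have := bopP A; rewrite inE /= => -[]. Qed.

Lemma bop_comp_subproof (A B : bop) : (A \o B) \in bounded_operator.
Proof.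
rewrite inE /=; split=> [k x y|]; first by rewrite /= !linearP.
have [M MA] := bop_bounded A; have [N NB] := bop_bounded B.
exists (Num.max M 0 * N) => x; rewrite /= (le_trans (MA _))//.
apply: (@le_trans _ _ ((Num.max M 0)%:C * `|B x|)).
  by rewrite ler_wpM2r// lecR le_max lexx.
by rewrite rmorphM /= -mulrA ler_wpM2l// lecR le_max lexx orbT.
Qed.

Definition bop_comp (A B : bop) : bop := Bop (bop_comp_subproof A B).

Definition positive_op (A : bop) : Prop := forall x, 0 <= inner x (A x).

Definition compact_op (A : bop) : Prop :=
  precompact (A @` [set x | `|x| <= 1]).

Definition eigenvector (A : bop) (x : H) : Prop :=
  x != 0 /\ exists c : R[i], A x = c *: x.

(* [x] satisfies (A^* A) x = s^2 x, where A^* A is the operator determined by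
   <y, A^* A x> = <A y, A x> for all y. *)
Definition singular_vector (A : bop) (s : R) (x : H) : Prop :=
  forall y, inner (A y) (A x) = inner y ((s ^+ 2)%:C *: x).

(* The [n.+1]-st largest eigenvalue of |A| = (A^* A)^(1/2), repetitions
   according to multiplicity: the largest [t] such that |A| has [n.+1]
   orthonormal eigenvectors with eigenvalues at least [t], and 0 if there are
   no [n.+1] orthonormal eigenvectors. *)
Definition singular_value (A : bop) (n : nat) : R :=
  sup [set t | exists2 e : 'I_n.+1 -> H, orthonormal_system e &
    forall i, exists s : R, [/\ 0 <= s, t <= s & singular_vector A s (e i)]].

Lemma singular_value_ge0 (A : bop) (n : nat) : 0 <= singular_value A n.
Proof.
rewrite /singular_value; set S := [set t | _].
have [hS|/sup_out-> //] := pselect (has_sup S).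
have [[t [e oe he]] ub] := hS; apply: (ub_le_sup ub).
by exists e => // i; have [s [s0 ts vs]] := he i; exists s.
Qed.

End bounded_operators.

Section bounded_sequences.
Context (R : realType).

Definition bounded_seq : {pred nat -> R[i]^o} :=
  [pred a : nat -> R[i]^o | `[< exists M : R, forall n, `|a n| <= M%:C >]].

Lemma bounded_seq_submod_closed : submod_closed bounded_seq.
Proof.
split=> [|c a b].
  by rewrite inE /=; exists 0 => n; rewrite normr0.
rewrite !inE /= => -[M Ma] [N Nb].
have [m hm] : exists m : R, `|c| = m%:C by exists (complex.Re `|c|); rewrite RRe_real.
exists (m * M + N) => n; rewrite /= !fctE (le_trans (ler_normD _ _))//.
by rewrite normrM rmorphD rmorphM /= -hm lerD// ler_wpM2l.
Qed.

HB.instance Definition _ :=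
  GRing.isSubmodClosed.Build R[i] (nat -> R[i]^o) bounded_seq
    bounded_seq_submod_closed.

(* The sequence {a_k}, k >= 1, is represented by [a : linf] with
   [a n] = a_(n+1). *)
Record linf := Linf { linf_seq :> nat -> R[i]^o ; linfP : linf_seq \in bounded_seq }.

HB.instance Definition _ := [isSub for linf_seq].
HB.instance Definition _ := [Choice of linf by <:].
HB.instance Definition _ := [SubChoice_isSubLmodule of linf by <:].

Lemma linf_bounded (a : linf) : exists M : R, forall n, `|a n| <= M%:C.
Proof. by have := linfP a; rewrite inE. Qed.

Lemma linf_one_subproof : (fun=> 1) \in bounded_seq.
Proof. by rewrite inE /=; exists 1 => n; rewrite normr1. Qed.

Definition linf_one : linf := Linf linf_one_subproof.

Definition linf_state (xi : linf -> R[i]) : Prop :=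
  [/\ scalar xi,
      forall a : linf, (forall n, 0 <= a n) -> 0 <= xi a &
      xi linf_one = 1].

Definition generalised_limit (L : linf -> R[i]) : Prop :=
  linf_state L /\ forall a : linf, (forall n, 0 <= a n) ->
    (limn_inf (fun n => complex.Re (a n)))%:C <= L a
      <= (limn_sup (fun n => complex.Re (a n)))%:C.

Lemma linf_reindex_subproof (f : nat -> nat) (a : linf) :
  (fun n => a (f n)) \in bounded_seq.
Proof.
by have [M Ma] := linf_bounded a; rewrite inE /=; exists M.
Qed.

Definition shift_seq (j : nat) (a : linf) : linf :=
  Linf (linf_reindex_subproof (fun n => n + j)%N a).

(* ceil((n + 1) / j) = n %/ j + 1 for j >= 1. *)
Definition dilate_seq (j : nat) (a : linf) : linf :=
  Linf (linf_reindex_subproof (fun n => n %/ j)%N a).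

Definition BL : set (linf -> R[i]) :=
  [set xi | linf_state xi /\ forall j, (0 < j)%N -> xi \o shift_seq j = xi].

Definition DL : set (linf -> R[i]) :=
  [set xi | linf_state xi /\ forall j, (0 < j)%N -> xi \o dilate_seq j = xi].

End bounded_sequences.

Section Cesaro_log_map.
Context (R : realType).
Import HBNNSimple.

Lemma normc_ge_Im (x : R[i]) : `|complex.Im x|%:C <= `|x|.
Proof.
by case: x => a b; simpc; rewrite -sqrtr_sqr ler_wsqrtr // lerDr sqr_ge0.
Qed.

Lemma normc_real (x : R) : `|x%:C| = `|x|%:C.
Proof. by rewrite normc_def/= expr0n addr0 sqrtr_sqr. Qed.

(* Elements of the L^oo spaces are given by representatives R -> R[i], whose
   values outside of [0, +oo[ (resp. [1, +oo[) are never used. *)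
Definition complex_integral (A : set R) (f : R -> R[i]) : R[i] :=
  (\int[lebesgue_measure]_(t in A) complex.Re (f t)) +i*
  (\int[lebesgue_measure]_(t in A) complex.Im (f t)).

Definition E_map (f : R -> R[i]) : nat -> R[i] :=
  fun n => complex_integral `[n%:R, n.+1%:R] f.

Definition Linv_map (g : R -> R[i]) : R -> R[i] := fun t => g (expR t).

(* A finitely supported sum for every [t]; [a n] = a_(n+1) goes with the
   interval [n+1, n+2[. *)
Definition p_map (a : nat -> R[i]) : R -> R[i] :=
  fun t => \sum_(n \in [set: nat]) a n * \1_(`[n.+1%:R, n.+2%:R[%classic : set R) t.

Lemma p_map_bounded (a : linf R) :
  exists M : R, forall t, `|p_map a t| <= M%:C.
Proof.
have [M Ma] := linf_bounded a; exists M => t.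
have M0 : 0 <= M%:C by exact: le_trans (Ma 0).
have [[n tn]|nt] := pselect (exists n, t \in (`[n.+1%:R, n.+2%:R[%classic : set R)).
  rewrite /p_map -(@fsbig_widen _ _ _ _ [set n])//.
    by rewrite fsbig_set1 indicE tn mulr1.
  move=> k [_ kn] /=; rewrite indicE (_ : (t \in _) = false) ?mulr0//.
  apply/negbTE/negP; rewrite inE => tk; apply: kn; move: tn; rewrite inE.
  move: tk; rewrite /= !in_itv/= => /andP[k1 k2] /andP[n1 n2].
  have := le_lt_trans k1 n2; have := le_lt_trans n1 k2.
  by rewrite !ltr_nat; lia.
rewrite /p_map fsbig1 ?normr0// => k _; rewrite indicE.
case tk: (t \in _); last by rewrite mulr0.
by case: nt; exists k.
Qed.

Lemma norm_Rintegral_unit (D : set R) (f : R -> R) (M : R) :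
  measurable D -> lebesgue_measure D = 1%E -> (forall t, `|f t| <= M) ->
  `|\int[lebesgue_measure]_(t in D) f t| <= M.
Proof.
move=> mD D1 fM.
have pos (g : R -> \bar R) : (forall t, 0 <= g t)%E -> (forall t, g t <= M%:E)%E ->
    (0 <= \int[lebesgue_measure]_(t in D) g t <= M%:E)%E.
  move=> g0 gM; rewrite integral_ge0//= ge0_integralE//.
  apply: ge_ereal_sup => _ [h /= hg <-].
  have hD : h \_ D = h :> (R -> R).
    apply/funext => t; rewrite patchE; case: ifPn => // tD.
    have := hg t; rewrite patchE (negbTE tD) lee_fin => h0.
    by apply/eqP; rewrite eq_le h0 fun_ge0.
  rewrite -hD -integral_nnsfun//.
  have -> : M%:E = (\int[lebesgue_measure]_(t in D) (cst M%:E t))%E.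
    by rewrite integral_cst//= D1 mule1.
  apply: ge0_le_integral => //.
  - by move=> t _; rewrite lee_fin.
  - by apply/measurable_realfun.measurable_EFinP/measurable_funTS.
  - move=> t tD; have := hg t; rewrite patchE mem_set// => /le_trans; apply.
    exact: gM.
rewrite /Rintegral integralE.
have fp t : ((EFin \o f)^\+ t <= M%:E)%E.
  rewrite funeposE /= ge_max !lee_fin (le_trans (ler_norm _) (fM t))/=.
  exact: le_trans (fM t).
have fn t : ((EFin \o f)^\- t <= M%:E)%E.
  rewrite funenegE /= ge_max !lee_fin (le_trans (normr_ge0 _) (fM t)) andbT.
  by rewrite (le_trans (ler_norm _))// normrN.
have /andP[] := pos _ (@funepos_ge0 _ _ (EFin \o f)) fp.
have /andP[] := pos _ (@funeneg_ge0 _ _ (EFin \o f)) fn.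
move: (integral _ _ _) (integral _ _ _) => [x||] [y||]//=.
rewrite !lee_fin => x0 xM y0 yM.
by rewrite ler_norml; apply/andP; split; lra.
Qed.

Lemma calL_subproof (a : linf R) :
  E_map (Linv_map (p_map a)) \in bounded_seq (R := R).
Proof.
have [M pM] := p_map_bounded a; rewrite inE; exists (M + M) => n.
have mI : measurable (`[n%:R, n.+1%:R]%classic : set R) by [].
have I1 : lebesgue_measure (`[n%:R, n.+1%:R]%classic : set R) = 1%E.
  rewrite lebesgue_measure_itv/= lte_fin ltr_nat ltnSn -EFinB.
  by rewrite -natrB// subSnn.
rewrite /E_map /complex_integral; set x := Rintegral _ _ _; set y := Rintegral _ _ _.
have -> : x +i* y = x%:C + 'i%C * y%:C by simpc.
rewrite rmorphD (le_trans (ler_normD _ _))// normrM lerD//.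
  rewrite normc_real lecR; apply: norm_Rintegral_unit => // t.
  by rewrite -lecR (le_trans (normc_ge_Re _)) ?pM.
have -> : `|'i%C : R[i]| = 1 by rewrite normc_def/= expr0n expr1n add0r sqrtr1.
rewrite mul1r normc_real lecR; apply: norm_Rintegral_unit => // t.
by rewrite -lecR (le_trans (normc_ge_Im _)) ?pM.
Qed.

Definition calL (xi : linf R -> R[i]) : linf R -> R[i] :=
  fun a => xi (Linf (calL_subproof a)).

End Cesaro_log_map.

Section Dixmier_traces.
Context (R : realType) (H : hilbertType R).
Implicit Types (S T A : bop H) (w : linf R -> R[i]).

Definition gamma_seq T : nat -> R :=
  fun n => (ln n.+2%:R)^-1 * \sum_(j < n.+1) singular_value T j.

Definition weakL1 : set (bop H) :=
  [set T | compact_op T /\ has_ubound (range (gamma_seq T))].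

Lemma gamma_subproof T :
  weakL1 T -> (fun n => (gamma_seq T n)%:C) \in bounded_seq (R := R).
Proof.
move=> [_ [M TM]]; rewrite inE; exists M => n.
rewrite normc_real lecR ger0_norm; first by apply: TM; exists n.
by rewrite mulr_ge0 ?invr_ge0 ?ln_ge0 ?ler1n// sumr_ge0// => j _;
  rewrite singular_value_ge0.
Qed.

Definition linf_gamma T (hT : weakL1 T) : linf R := Linf (gamma_subproof hT).

Definition DL2 : set (linf R -> R[i]) :=
  [set w | generalised_limit w /\
    forall S (hS : weakL1 S), positive_op S ->
      w (dilate_seq 2 (linf_gamma hS)) = w (linf_gamma hS)].

Definition linear_extension w (tau : bop H -> R[i]) : Prop :=
  (forall c S T, weakL1 S -> weakL1 T ->
    tau (c *: S + T) = c * tau S + tau T) /\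
  (forall S (hS : weakL1 S), positive_op S -> tau S = w (linf_gamma hS)).

(* The linear extension to [weakL1] of S |-> w (linf_gamma S).  Its values on
   [weakL1] are determined by w since [weakL1] is the linear span of its
   positive elements; its values outside of [weakL1] are irrelevant. *)
Definition Tr w : bop H -> R[i] := xget (fun=> 0) (linear_extension w).

Definition phi_Tr w T A : R[i] := Tr w (bop_comp A T) / Tr w T.

Lemma diagonal_seq_subproof (h : nat -> H) A :
  orthonormal_system h -> (fun m => inner (h m) (A (h m))) \in bounded_seq (R := R).
Proof.
move=> oh; have [M AM] := bop_bounded A; rewrite inE; exists M => m.
have h1 := orthonormal_system_norm oh m.
by rewrite (le_trans (inner_unit_le _ h1))// (le_trans (AM _))// h1 mulr1.
Qed.

Definition diagonal_seq (h : nat -> H) (oh : orthonormal_system h) A : linf R :=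
  Linf (diagonal_seq_subproof A oh).

End Dixmier_traces.

Arguments separable_space {R} H.
Arguments DL2 {R} H.

(* Main.v *)
Require Import Defs.
From HB Require Import structures.
From mathcomp Require Import all_boot all_order all_algebra.
From mathcomp Require Import complex.
From mathcomp Require Import all_classical all_reals all_analysis.
From mathcomp Require Import ring lra zify.
Set Implicit Arguments.
Unset Strict Implicit.
Unset Printing Implicit Defensive.
Import Order.TTheory GRing.Theory Num.Theory numFieldNormedType.Exports.
Local Open Scope classical_set_scope.
Local Open Scope ring_scope.
Local Open Scope complex_scope.

(* With M_a the multiplication by the bounded sequence a in the eigenbasis h, put
   L(a) := Tr_w(M_a T) / Tr_w(T); the point is that Tr_w(AT) = Tr_w(M_a T) for
   a_m := <h_m, A h_m>.  For bounded B put q(B) := Tr_w(B T B^* ) - Tr_w(M_d T),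
   where d_m := |B h_m|^2 is the diagonal of B^*B.  By the Ky Fan inequalities
   the partial sums of the singular values of
   B T B^* dominate those of M_d T, so that q >= 0; moreover q(1) = 0.  By
   Cauchy-Schwarz the polarization of q at (A, 1), which is
   Tr_w(AT) - Tr_w(M_a T), vanishes.  Finally L is a generalised limit because
   M_b T has finite rank for b of finite support, and then
   sum_(j <= n) mu_j(M_b T) = O(1) = o(log n).

   To see that [calL xi] belongs to DL2, put gamma := gamma(S).  With
   F(x) := \int_0^x p(gamma)(e^t) dt, the sequence E L^-1 p(gamma) is the
   increment F(n+1) - F(n), whereas that of D_2(gamma) is
   F(n+1-ln 2) - F(n-ln 2) + o(1), as gamma_(n+1) - gamma_n -> 0.  The
   difference of the two is a null sequence plus the increment of the bounded
   sequence F(n) - F(n-ln 2), on which xi vanishes. *)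

(** Tr_w is given by singular values only on positive operators, which A T need not be; squares B T
    B^* with B = A + z carry the information from positive operators to A T. The diagonal of B^*B
    enters because, for l_m the eigenvalues of T, the numbers l_m |B h_m|^2 are the diagonal in h of
    T^(1/2) B^*B T^(1/2), an operator with the same singular values as B T B^*: q >= 0 is Schur's
    majorization of a diagonal. The vectors sqrt(l_m) B h_m replace B T^(1/2) h_m, so that no root
    of T has to be formed. As q(1) = 0, the |z|^2 terms of q(A + z) cancel and a nonnegative affine
    function of z remains; such a function is constant, which is the form that Cauchy-Schwarz takes
    here. Linearity of Tr_w applies only to operators already known to lie in [weakL1]. Membership
    of the sums that occur is obtained from a bound on sesquilinear sums, which is additive by the
    triangle inequality. *)

(** * Norms and inner products *)

(* Norms are [R[i]]-valued in a normed module over [R[i]]. *)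
Definition rnorm (R : realType) (V : normedZmodType R[i]) (x : V) : R :=
  complex.Re `|x|.

Section real_norm.
Context (R : realType).
Implicit Types (V : normedZmodType R[i]) (z : R[i]).

Lemma normE V (x : V) : `|x| = (rnorm x)%:C.
Proof. by rewrite /rnorm RRe_real ?normr_real. Qed.

Lemma rnorm_ge0 V (x : V) : 0 <= rnorm x.
Proof. by rewrite -lecR -normE normr_ge0. Qed.

Lemma rnorm0 V : rnorm (0 : V) = 0.
Proof. by rewrite /rnorm normr0. Qed.

Lemma rnorm_eq0 V (x : V) : (rnorm x == 0) = (x == 0).
Proof. by rewrite -(normr_eq0 x) normE -[0 in RHS]/(0%:C) (inj_eq (@complexI R)). Qed.

Lemma rnormD V (x y : V) : rnorm (x + y) <= rnorm x + rnorm y.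
Proof. by rewrite -lecR rmorphD /= -!normE ler_normD. Qed.

Lemma rnormN V (x : V) : rnorm (- x) = rnorm x.
Proof. by rewrite /rnorm normrN. Qed.

Lemma rnorm_sub V (x y : V) : rnorm (x - y) = rnorm (y - x).
Proof. by rewrite -rnormN opprB. Qed.

Lemma rnormB V (x y : V) : rnorm (x - y) <= rnorm x + rnorm y.
Proof. by rewrite (le_trans (rnormD _ _)) // rnormN. Qed.

Lemma rnorm_dist V (x y : V) : `|rnorm x - rnorm y| <= rnorm (x - y).
Proof.
rewrite ler_norml; apply/andP; split.
  by rewrite rnorm_sub; have := rnormD (y - x) x; rewrite subrK; lra.
by have := rnormD (x - y) y; rewrite subrK; lra.
Qed.

Lemma rnormM z1 z2 : rnorm (z1 * z2) = rnorm z1 * rnorm z2.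
Proof. by apply: (@complexI R); rewrite rmorphM /= -!normE normrM. Qed.

Lemma rnorm_real (x : R) : rnorm (x%:C) = `|x|.
Proof. by rewrite /rnorm normc_real. Qed.

Lemma rnorm_conj z : rnorm (Num.conj z) = rnorm z.
Proof. by rewrite /rnorm norm_conjC. Qed.

Lemma sqr_rnorm z : (rnorm z ^+ 2)%:C = z * Num.conj z.
Proof. by rewrite rmorphXn /= -normE normCK. Qed.

Lemma Re_le_rnorm z : complex.Re z <= rnorm z.
Proof.
rewrite -lecR -normE; apply: le_trans (normc_ge_Re z).
by rewrite lecR ler_norm.
Qed.

End real_norm.

Section complex_facts.
Context (R : realType).
Implicit Types (z : R[i]).

Lemma Re_add z1 z2 : complex.Re (z1 + z2) = complex.Re z1 + complex.Re z2.
Proof. by case: z1 z2 => a b [c d]. Qed.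

Lemma Re_opp z : complex.Re (- z) = - complex.Re z.
Proof. by case: z. Qed.

Lemma Re_mulr z (x : R) : complex.Re (z * x%:C) = complex.Re z * x.
Proof. by case: z => a b /=; rewrite mulr0 subr0. Qed.

Lemma Re_mull z (x : R) : complex.Re (x%:C * z) = x * complex.Re z.
Proof. by rewrite mulrC Re_mulr mulrC. Qed.

Lemma Re_sum (I : Type) (r : seq I) (P : pred I) (F : I -> R[i]) :
  complex.Re (\sum_(i <- r | P i) F i) = \sum_(i <- r | P i) complex.Re (F i).
Proof. by elim/big_rec2: _ => // i y x _ <-; rewrite Re_add. Qed.

Lemma real_complex_sum (I : Type) (r : seq I) (P : pred I) (F : I -> R) :
  (\sum_(i <- r | P i) F i)%:C = \sum_(i <- r | P i) (F i)%:C.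
Proof. exact: rmorph_sum. Qed.

Lemma real_complexM (x y : R) : (x * y)%:C = x%:C * y%:C.
Proof. exact: rmorphM. Qed.

Lemma real_complexD (x y : R) : (x + y)%:C = x%:C + y%:C.
Proof. exact: rmorphD. Qed.

Lemma real_complexB (x y : R) : (x - y)%:C = x%:C - y%:C.
Proof. exact: rmorphB. Qed.

Lemma real_complexN (x : R) : (- x)%:C = - x%:C.
Proof. exact: rmorphN. Qed.

Lemma ge0_Re (z : R[i]) : 0 <= z -> 0 <= complex.Re z.
Proof. by rewrite lecE => /andP[]. Qed.

Lemma conj_real (x : R) : Num.conj x%:C = x%:C.
Proof. by apply/eqP; rewrite eq_complex /= oppr0 !eqxx. Qed.

Lemma ge0_complexE z : 0 <= z -> z = (complex.Re z)%:C.
Proof. by move=> z0; rewrite RRe_real// ger0_real. Qed.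

(** Near 0 the linear term wins in the direction -b. This is the first-order condition satisfied by
    a maximizer of |S x|. *)
Lemma quad_nonneg_linear0 (a : R) (b : R[i]) :
  (forall z, 0 <= rnorm z ^+ 2 * a + 2 * complex.Re (Num.conj z * b)) -> b = 0.
Proof.
move=> h; apply/eqP; rewrite -rnorm_eq0; apply/negPn/negP => b0.
have b1 : 0 < rnorm b by rewrite lt_neqAle eq_sym b0 rnorm_ge0.
(* At z = -t b the expression equals t |b|^2 (t a - 2), and this [t] gives t a < 1. *)
pose t := (`|a| + 1)^-1; have t0 : 0 < t by rewrite invr_gt0 ltr_wpDl.
have := h ((- t)%:C * b).
rewrite rmorphM /= conj_real -mulrA [Num.conj b * b]mulrC -sqr_rnorm.
rewrite -[(- t)%:C * (_ ^+ 2)%:C]rmorphM /= rnormM rnorm_real normrN (gtr0_norm t0) exprMn.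
set B := rnorm b ^+ 2; have B0 : 0 < B by rewrite exprn_gt0.
have ta : t * a < 1.
  rewrite (le_lt_trans (y := t * `|a|))//.
    by rewrite ler_wpM2l ?ler_norm// ltW.
  by rewrite /t mulrC ltr_pdivrMr ?ltr_wpDl// mul1r ltrDl.
have -> : t ^+ 2 * B * a + 2 * (- t * B) = (t * B) * (t * a - 2) by ring.
rewrite pmulr_rge0; last by rewrite mulr_gt0.
lra.
Qed.

End complex_facts.

Section inner_product.
Context (R : realType) (H : hilbertType R).
Implicit Types (x y u v : H) (c : R[i]).

Lemma innerE x : inner x x = (rnorm x ^+ 2)%:C.
Proof. by rewrite inner_norm normE rmorphXn. Qed.

Lemma inner0l x : inner 0 x = 0.
Proof. by rewrite inner_conj inner0r rmorph0. Qed.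

Lemma innerBr x y z : inner x (y - z : H) = inner x y - inner x z.
Proof. by rewrite innerDr innerNr. Qed.

Lemma innerBl x y z : inner (x - y : H) z = inner x z - inner y z.
Proof. by rewrite innerDl innerNl. Qed.

Lemma inner_sumr (I : Type) (r : seq I) (P : pred I) x (F : I -> H) :
  inner x (\sum_(i <- r | P i) F i) = \sum_(i <- r | P i) inner x (F i).
Proof.
by elim/big_rec2: _ => [|i y z _ <-]; rewrite ?inner0r// innerDr.
Qed.

Lemma inner_suml (I : Type) (r : seq I) (P : pred I) x (F : I -> H) :
  inner (\sum_(i <- r | P i) F i) x = \sum_(i <- r | P i) inner (F i) x.
Proof.
by elim/big_rec2: _ => [|i y z _ <-]; rewrite ?inner0l// innerDl.
Qed.

Lemma rnormZ c x : rnorm (c *: x) = rnorm c * rnorm x.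
Proof. by apply: (@complexI R); rewrite rmorphM /= -!normE normrZ. Qed.

Lemma rnorm_sqrD x y :
  rnorm (x + y) ^+ 2 = rnorm x ^+ 2 + rnorm y ^+ 2 + 2 * complex.Re (inner x y).
Proof.
apply: (@complexI R); rewrite -innerE innerDl !innerDr !innerE [inner y x]inner_conj.
rewrite -[in LHS](addrA) [in X in _ + X](addrA) addcJ !rmorphD !rmorphM /=.
by rewrite (_ : 2%:C = 2 :> R[i]); [ring|rewrite rmorph_nat].
Qed.

Lemma cauchy_schwarz x y : rnorm (inner x y) <= rnorm x * rnorm y.
Proof.
have [->|x0] := eqVneq x 0; first by rewrite inner0l !rnorm0 mul0r.
have r0 : 0 < rnorm x by rewrite lt_neqAle eq_sym rnorm_eq0 x0 rnorm_ge0.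
have := @inner_unit_le R H ((rnorm x)^-1%:C *: x) y.
rewrite innerZl conj_real !normE lecR rnormM !rnormZ !rnorm_real.
rewrite gtr0_norm ?invr_gt0// mulVf ?gt_eqF// => /(_ erefl).
by rewrite ler_pdivrMl.
Qed.

Lemma inner_ext x y : (forall z, inner z x = inner z y) -> x = y.
Proof.
move=> h; apply/eqP; rewrite -subr_eq0 -rnorm_eq0 -sqrf_eq0.
by apply/eqP/(@complexI R); rewrite -innerE innerBr h subrr.
Qed.

Section finite_orthonormal.
Context (I : finType) (e : I -> H) (oe : orthonormal_system e).

Lemma inner_lincomb (c : I -> R[i]) i : inner (e i) (\sum_j c j *: e j) = c i.
Proof.
rewrite inner_sumr (bigD1 i)//= innerZr oe eqxx mulr1 big1 ?addr0// => j ji.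
by rewrite innerZr oe eq_sym (negbTE ji) mulr0.
Qed.

Lemma rnorm_lincomb (c : I -> R[i]) :
  rnorm (\sum_j c j *: e j) ^+ 2 = \sum_j rnorm (c j) ^+ 2.
Proof.
apply: (@complexI R); rewrite -innerE inner_suml real_complex_sum.
by apply: eq_bigr => i _; rewrite innerZl inner_lincomb sqr_rnorm mulrC.
Qed.

Lemma rnorm_residual x :
  rnorm (x - \sum_j inner (e j) x *: e j) ^+ 2 =
  rnorm x ^+ 2 - \sum_j rnorm (inner (e j) x) ^+ 2.
Proof.
apply: (@complexI R); rewrite -innerE innerBr !innerBl innerE.
rewrite [inner (\sum_j _) (\sum_j _)]innerE rnorm_lincomb.
have -> : inner x (\sum_j inner (e j) x *: e j) =
    (\sum_j rnorm (inner (e j) x) ^+ 2)%:C.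
  rewrite inner_sumr real_complex_sum; apply: eq_bigr => i _.
  by rewrite innerZr [inner x _]inner_conj sqr_rnorm.
rewrite inner_suml (_ : \sum_i inner _ x = (\sum_j rnorm (inner (e j) x) ^+ 2)%:C).
  by rewrite rmorphB /=; ring.
rewrite real_complex_sum; apply: eq_bigr => i _.
by rewrite innerZl mulrC sqr_rnorm.
Qed.

Lemma bessel x : \sum_j rnorm (inner (e j) x) ^+ 2 <= rnorm x ^+ 2.
Proof. by rewrite -subr_ge0 -rnorm_residual sqr_ge0. Qed.

Lemma residual_orth x i : inner (e i) (x - \sum_j inner (e j) x *: e j) = 0.
Proof. by rewrite innerBr inner_lincomb subrr. Qed.

End finite_orthonormal.

(** Dimension count: n linear conditions on n + 1 coefficients, so the left kernel of the matrix of
    inner products is nonzero. *)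
Lemma exists_orthogonal (n : nat) (e : 'I_n.+1 -> H) (f : 'I_n -> H) :
  orthonormal_system e ->
  exists c : 'I_n.+1 -> R[i], let x := \sum_i c i *: e i in
    rnorm x = 1 /\ forall j, inner (f j) x = 0.
Proof.
move=> oe; pose A := \matrix_(i < n.+1, j < n) inner (f j) (e i).
have kA : kermx A != 0.
  by rewrite kermx_eq0 /row_free ltn_eqF// ltnS rank_leq_col.
pose v := nz_row (kermx A).
have vA : v *m A = 0 by apply/sub_kermxP; rewrite nz_row_sub.
have v0 : v != 0 by rewrite nz_row_eq0.
pose y := \sum_i v ord0 i *: e i.
have y0 : rnorm y != 0.
  apply: contraNneq v0 => yn; apply/eqP/rowP => i; rewrite mxE.
  rewrite -(inner_lincomb oe (fun i => v ord0 i)) -/y.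
  by move/eqP: yn; rewrite rnorm_eq0 => /eqP ->; rewrite inner0r.
exists (fun i => (rnorm y)^-1%:C * v ord0 i) => x.
have -> : x = (rnorm y)^-1%:C *: y.
  by rewrite /x /y scaler_sumr; apply: eq_bigr => i _; rewrite scalerA.
split; first by rewrite rnormZ rnorm_real ger0_norm ?invr_ge0 ?rnorm_ge0// mulVf.
move=> j; rewrite innerZr inner_sumr.
have := congr1 (fun M : 'rV_n => M ord0 j) vA; rewrite !mxE => vAj.
rewrite [X in _ * X](_ : _ = 0) ?mulr0// -[RHS]vAj.
by apply: eq_bigr => i _; rewrite innerZr mxE.
Qed.

End inner_product.

(** * Compact operators and singular vectors *)

Section convergence.
Context (R : realType) (H : hilbertType R).
Implicit Types (u : nat -> H) (x l : H) (S : bop H).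

(** Convergence with real radii, since the norm and the balls of H take their values and radii in
    R[i]. *)
Definition tends u l : Prop :=
  forall e : R, 0 < e -> exists N, forall n, (N <= n)%N -> rnorm (u n - l) < e.

Lemma pos_complexP (e : R[i]) : 0 < e -> exists2 r : R, 0 < r & e = r%:C.
Proof.
move=> e0; exists (complex.Re e); last exact/ge0_complexE/ltW.
by rewrite -ltcR -ge0_complexE// ltW.
Qed.

Lemma ball_rnorm (V : normedModType R[i]) (x y : V) (e : R) :
  ball x e%:C y = (rnorm (x - y) < e) :> Prop.
Proof. by rewrite -ball_normE /= normE ltcR. Qed.

Lemma cauchy_tends u :
  (forall e : R, 0 < e -> exists N, forall m n, (N <= m)%N -> (N <= n)%N ->
    rnorm (u m - u n) < e) -> exists l, tends u l.
Proof.
move=> cu; have /cauchy_cvgP/cvg_ex[l ul] : cauchy (u @ \oo).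
  apply: cauchy_exP => _ /pos_complexP[e e0 ->]; have [N uN] := cu e e0.
  exists (u N); exists N => // n /= Nn.
  by rewrite ball_rnorm; apply: uN.
exists l => e e0.
move/cvgrPdistC_lt: ul => /(_ e%:C); rewrite ltcR => /(_ e0)[N _ uN].
by exists N => n Nn; have := uN n Nn; rewrite normE ltcR.
Qed.

Lemma bop_bound S : exists2 M : R, 0 <= M & forall x, rnorm (S x) <= M * rnorm x.
Proof.
have [M SM] := bop_bounded S; exists (Num.max M 0); first by rewrite le_max lexx orbT.
move=> x; have := SM x; rewrite !normE -rmorphM lecR /= => /le_trans; apply.
by rewrite ler_wpM2r ?rnorm_ge0// le_max lexx.
Qed.

Lemma tends_bop S u l : tends u l -> tends (S \o u) (S l).
Proof.
have [M M0 SM] := bop_bound S.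
move=> ul e e0; have [|N uN] := ul (e / (M + 1)).
  by rewrite divr_gt0// ltr_wpDl.
exists N => n Nn; rewrite /= -linearB (le_lt_trans (SM _))//.
rewrite (le_lt_trans (y := (M + 1) * rnorm (u n - l)))//.
  by rewrite ler_wpM2r ?rnorm_ge0// lerDl.
by rewrite mulrC -ltr_pdivlMr ?ltr_wpDl// uN.
Qed.

Lemma tends_inner u l x : tends u l -> forall e : R, 0 < e ->
  exists N, forall n, (N <= n)%N -> rnorm (inner x (u n) - inner x l) < e.
Proof.
move=> ul e e0; have [|N uN] := ul (e / (rnorm x + 1)).
  by rewrite divr_gt0// ltr_wpDl ?rnorm_ge0.
exists N => n Nn; rewrite -innerBr (le_lt_trans (cauchy_schwarz _ _))//.
rewrite (le_lt_trans (y := (rnorm x + 1) * rnorm (u n - l)))//.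
  by rewrite ler_wpM2r ?rnorm_ge0// lerDl.
by rewrite mulrC -ltr_pdivlMr ?ltr_wpDl ?rnorm_ge0// uN.
Qed.

Lemma compact_opP S :
  compact_op S <-> exists2 K, compact K & forall x, rnorm x <= 1 -> K (S x).
Proof.
split=> [|[K cK SK]].
  rewrite /compact_op precompactE => cS; exists (closure (S @` [set x | `|x| <= 1])) => //.
  by move=> x x1; apply: subset_closure; exists x => //=; rewrite normE lecR.
apply: precompact_subset (compact_precompact (@norm_hausdorff _ _) cK).
by move=> _ [x /= x1 <-]; apply: SK; rewrite -lecR -normE.
Qed.

Lemma compact_op_cluster S u : compact_op S -> (forall n, rnorm (u n) <= 1) ->
  exists z, forall (e : R) N, 0 < e ->
    exists2 k, (N <= k)%N & rnorm (S (u k) - z) < e.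
Proof.
move=> /compact_opP[K cK SK] u1.
have [|z [_ zc]] := cK ((S \o u) @ \oo) _.
  by exists 0%N => // n _ /=; apply: SK.
exists z => e N e0.
have [|| _ [[k Nk <-]]] :=
  zc ((S \o u) @` [set k | (N <= k)%N]) (ball z e%:C).
- by exists N => // n /= Nn; exists n.
- by apply: nbhsx_ballx; rewrite ltcR.
by rewrite ball_rnorm rnorm_sub => ?; exists k.
Qed.

Lemma bop_continuous S : continuous (S : H -> H).
Proof.
move=> x; apply/cvgrPdist_lt => _ /pos_complexP[e e0 ->].
have [M M0 SM] := bop_bound S.
have d0 : 0 < e / (M + 1) by rewrite divr_gt0// ltr_wpDl.
apply/nbhs_ballP; exists (e / (M + 1))%:C => /=; first by rewrite ltcR.
move=> y; rewrite ball_rnorm => xy; rewrite normE ltcR -linearB (le_lt_trans (SM _))//.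
rewrite (le_lt_trans (y := (M + 1) * rnorm (x - y)))//.
  by rewrite ler_wpM2r ?rnorm_ge0// lerDl.
by rewrite mulrC -ltr_pdivlMr ?ltr_wpDl.
Qed.

Lemma compact_op_compl S B : compact_op S -> compact_op (bop_comp B S).
Proof.
move=> /compact_opP[K cK SK]; apply/compact_opP; exists (B @` K).
  by apply: continuous_compact => //; apply/continuous_subspaceT/bop_continuous.
by move=> x x1; exists (S x) => //; apply: SK.
Qed.

Lemma compact_op_scale S c : compact_op S -> compact_op (c *: S).
Proof.
move=> /compact_opP[K cK SK]; apply/compact_opP; exists ([eta *:%R c] @` K).
  apply: continuous_compact => //; apply/continuous_subspaceT => x.
  exact: scaler_continuous.
by move=> x x1; exists (S x) => //; apply: SK.
Qed.

Lemma compact_op_compr S B : compact_op S -> compact_op (bop_comp S B).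
Proof.
have [M M0 BM] := bop_bound B; have M1 : 0 < M + 1 by rewrite ltr_wpDl.
(* B maps the unit ball into the ball of radius M + 1, and this factor is absorbed in S; adding 1
   keeps it invertible. *)
move=> /(@compact_op_scale _ (M + 1)%:C)/compact_opP[K cK SK].
apply/compact_opP; exists K => // x x1.
have -> : bop_comp S B x = ((M + 1)%:C *: S) ((M + 1)^-1%:C *: B x).
  rewrite [RHS]linearZ /= scalerA -rmorphM /= mulVf ?scale1r//.
  by rewrite gt_eqF.
apply: SK; rewrite rnormZ rnorm_real gtr0_norm ?invr_gt0//.
rewrite ler_pdivrMl// mulr1 (le_trans (BM x))//.
by rewrite (le_trans (ler_wpM2l M0 x1))// mulr1 lerDl.
Qed.

Lemma compact_op_add S B : compact_op S -> compact_op B -> compact_op (S + B).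
Proof.
move=> /compact_opP[K cK SK] /compact_opP[L cL BL]; apply/compact_opP.
exists ((fun p : H * H => p.1 + p.2) @` (K `*` L)).
  apply: continuous_compact; last exact: compact_setX.
  by apply/continuous_subspaceT => x; apply: add_continuous.
by move=> x x1; exists (S x, B x) => //; split => /=; [apply: SK|apply: BL].
Qed.

End convergence.

Lemma exists_vanishing_seq (R : realType) : exists d : nat -> R,
  [/\ forall n, 0 < d n, forall m n, (m <= n)%N -> d n <= d m &
    forall e, 0 < e -> exists N, forall n, (N <= n)%N -> d n < e].
Proof.
exists (fun n => n.+1%:R^-1); split => [n|m n mn|e e0].
- by rewrite invr_gt0.
- by rewrite lef_pV2 ?posrE// ler_nat ltnS.
exists (Num.bound e^-1) => n Nn.
rewrite invf_plt ?posrE//; apply: lt_le_trans (archi_boundP _) _.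
  by rewrite invr_ge0 ltW.
by rewrite ler_nat (leq_trans Nn).
Qed.

Section singular_vectors.
Context (R : realType) (H : hilbertType R).
Implicit Types (S : bop H).

(** Along a maximizing sequence u_j, compactness gives a subsequence with S u_j convergent to some z
    with |z| >= M. Then |S (u_i + u_j)| is close to 2 M, so |u_i + u_j| is close to 2, and the
    parallelogram law makes the unit vectors u_j a Cauchy sequence; its limit attains the supremum
    M. *)
Lemma exists_maximizer (I : Type) (f : I -> H) S : compact_op S ->
  (exists x, rnorm x = 1 /\ forall i, inner (f i) x = 0) ->
  exists v, [/\ rnorm v = 1, forall i, inner (f i) v = 0 &
    forall u, (forall i, inner (f i) u = 0) ->
      rnorm (S u) <= rnorm (S v) * rnorm u].
Proof.
move=> cS [x0 [x01 x0f]].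
pose A := [set r | exists x, [/\ rnorm x = 1, forall i, inner (f i) x = 0
  & r = rnorm (S x)]].
have [C C0 SC] := bop_bound S.
have hA : has_sup A.
  split; first by exists (rnorm (S x0)), x0.
  by exists C => _ [x [x1 _ ->]]; rewrite (le_trans (SC x))// x1 mulr1.
pose M := sup A.
have leM u : (forall i, inner (f i) u = 0) -> rnorm (S u) <= M * rnorm u.
  move=> uf; have [->|u0] := eqVneq u 0; first by rewrite linear0 !rnorm0 mulr0.
  have r0 : 0 < rnorm u by rewrite lt_neqAle eq_sym rnorm_eq0 u0 rnorm_ge0.
  rewrite -ler_pdivrMr//; apply: (ub_le_sup hA.2).
  exists ((rnorm u)^-1%:C *: u); split.
  - by rewrite rnormZ rnorm_real gtr0_norm ?invr_gt0// mulVf ?gt_eqF.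
  - by move=> i; rewrite innerZr uf mulr0.
  - by rewrite linearZ /= rnormZ rnorm_real gtr0_norm ?invr_gt0// mulrC.
suff [v [v1 vf Mv]] : exists v, [/\ rnorm v = 1, forall i, inner (f i) v = 0 &
    M <= rnorm (S v)].
  exists v; split => // u /leM /le_trans; apply.
  by rewrite ler_wpM2r// rnorm_ge0.
(* For M <= 0 every admissible unit vector is a maximizer; otherwise M can be cancelled below. *)
have [M0|M0] := leP M 0; first by exists x0; split => //; rewrite (le_trans M0) ?rnorm_ge0.
have [d_ [d_gt0 d_anti d_lt]] := exists_vanishing_seq R.
have /choice[v vP] : forall n, exists x, [/\ rnorm x = 1,
    forall i, inner (f i) x = 0 & M - d_ n < rnorm (S x)].
  move=> n; have [_ [x [x1 xf ->]] lx] := sup_adherent (d_gt0 n) hA.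
  by exists x.
have [|z zP] := @compact_op_cluster _ _ S v cS; first by move=> n; have [->] := vP n.
have /choice[k kP] : forall j, exists k, (j <= k)%N /\ rnorm (S (v k) - z) < d_ j.
  by move=> j; have [k jk kz] := zP _ j (d_gt0 j); exists k.
pose u := v \o k.
have u1 j : rnorm (u j) = 1 by have [] := vP (k j).
have uf j i : inner (f i) (u j) = 0 by have [] := vP (k j).
have Su j : M - d_ j < rnorm (S (u j)).
  have [_ _] := vP (k j); apply: le_lt_trans; rewrite lerD2l lerN2.
  by apply: d_anti; have [] := kP j.
have Mz : M <= rnorm z.
  apply/ler_addgt0Pr => e e0; have e2 : 0 < e / 2 by rewrite divr_gt0.
  have [j /(_ _ (leqnn _)) je] := d_lt _ e2.
  have [_] := kP j; have := Su j; rewrite /u/=.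
  by have := rnormD (S (v (k j)) - z) z; rewrite subrK; lra.
have [|w uw] := @cauchy_tends _ _ u.
  (* With this [d], 2 M - 2 d < M |u_i + u_j| reads |u_i + u_j| > 2 - e^2/4, whence |u_i - u_j|^2 =
     4 - |u_i + u_j|^2 < e^2. *)
  move=> e e0; pose d := M * e ^+ 2 / 8.
  have d0 : 0 < d by rewrite divr_gt0// mulr_gt0// exprn_gt0.
  have [N Nd] := d_lt _ d0; exists N => i j Ni Nj.
  rewrite -(@ltr_pXn2r _ 2) ?nnegrE ?rnorm_ge0 ?ltW//.
  have /(_ (u i) (u j)) := @rnorm_sqrD R H.
  have /(_ (u i) (- u j)) := @rnorm_sqrD R H.
  rewrite rnormN innerNr Re_opp !u1 !expr1n => -> h2.
  have := leM (u i + u j); have := rnormD (S (u i + u j)) ((z - S (u i)) + (z - S (u j))).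
  have -> : S (u i + u j) + ((z - S (u i)) + (z - S (u j))) = z + z.
    by rewrite linearD addrACA [_ + (z - _)]addrC [_ + (z - S (u j))]addrC !subrK.
  have -> : z + z = 2%:C *: z by rewrite -mulr2n -scaler_nat rmorph_nat.
  rewrite rnormZ rnorm_real gtr0_norm//.
  have := rnormD (z - S (u i)) (z - S (u j)).
  have [_] := kP i; have [_] := kP j; have := Nd _ Ni; have := Nd _ Nj.
  rewrite !(rnorm_sub _ z) /u /=.
  set a := rnorm (S (v (k i)) - z); set b := rnorm (S (v (k j)) - z).
  move=> jd id bj ai h3 h4 h5.
  have {}h5 : rnorm (S (u i + u j)) <= M * rnorm (u i + u j).
    by apply: h5 => l; rewrite innerDr !uf addr0.
  move: h2 h4 h5; rewrite /u/=.
  set q := rnorm (_ + _); set r := complex.Re _ => h2 h4 h5.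
  have q0 : 0 <= q by exact: rnorm_ge0.
  have h6 : M * 2 - 2 * d < M * q by lra.
  have h7 : M * (2 - e ^+ 2 / 4) < M * q.
    by rewrite (le_lt_trans _ h6)// /d; lra.
  rewrite (ltr_pM2l M0) in h7.
  have h8 : 4 - q ^+ 2 < e ^+ 2.
    have [qs|qs] := leP (2 - e ^+ 2 / 4) 0.
      by have := sqr_ge0 q; have := exprn_gt0 2 e0; nra.
    by nra.
  lra.
exists w; split.
- apply/eqP; rewrite -subr_eq0 -normr_eq0; apply/eqP/le_anti; rewrite normr_ge0 andbT.
  apply/ler_addgt0Pr => e e0; have [N /(_ _ (leqnn _)) Ne] := uw e e0.
  rewrite add0r -(u1 N) distrC; apply: le_trans (ltW Ne).
  exact: rnorm_dist.
- move=> i; apply/eqP; rewrite -rnorm_eq0; apply/eqP/le_anti; rewrite rnorm_ge0 andbT.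
  apply/ler_addgt0Pr => e e0; have [N /(_ _ (leqnn _))] := tends_inner (f i) uw e0.
  by rewrite uf sub0r rnormN add0r => /ltW.
- apply/ler_addgt0Pr => e e0; have e2 : 0 < e / 2 by rewrite divr_gt0.
  have [N Ne] := tends_bop S uw e2; have [N' Ne'] := d_lt _ e2.
  have := Ne _ (leq_maxl N N'); have := Ne' _ (leq_maxr N N').
  have := Su (maxn N N'); have := rnormD (S (u (maxn N N')) - S w) (S w).
  by rewrite subrK /=; lra.
Qed.

End singular_vectors.

Section singular_systems.
Context (R : realType) (H : hilbertType R).
Implicit Types (S : bop H).

Lemma rnorm_singular_lincomb S (I : finType) (e : I -> H) (s : I -> R)
    (c : I -> R[i]) :
  orthonormal_system e -> (forall i, singular_vector S (s i) (e i)) ->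
  rnorm (S (\sum_i c i *: e i)) ^+ 2 = \sum_i s i ^+ 2 * rnorm (c i) ^+ 2.
Proof.
move=> oe se; apply: (@complexI R); rewrite -innerE [X in inner _ X]linear_sum.
rewrite inner_sumr real_complex_sum; apply: eq_bigr => i _.
rewrite linearZ /= innerZr (se i) innerZr [inner _ (e i)]inner_conj.
by rewrite inner_lincomb// [RHS]real_complexM sqr_rnorm; ring.
Qed.

Lemma rnorm_singular_vector S s x : 0 <= s -> singular_vector S s x ->
  rnorm (S x) = s * rnorm x.
Proof.
move=> s0 sx; apply/eqP; rewrite -(@eqrXn2 _ 2) ?mulr_ge0 ?rnorm_ge0//.
by apply/eqP/(@complexI R); rewrite -innerE sx innerZr innerE -rmorphM exprMn.
Qed.

Definition singular_value_bounds S n : set R :=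
  [set t | exists2 e : 'I_n.+1 -> H, orthonormal_system e &
    forall i, exists s : R, [/\ 0 <= s, t <= s & singular_vector S s (e i)]].

Lemma orthonormal_rnorm (I : eqType) (e : I -> H) i :
  orthonormal_system e -> rnorm (e i) = 1.
Proof. by move=> oe; rewrite /rnorm (orthonormal_system_norm oe). Qed.

Lemma has_ubound_singular_value_bounds S n :
  has_ubound (singular_value_bounds S n).
Proof.
have [C C0 SC] := bop_bound S; exists C => t [e oe he].
have [s [s0 ts se]] := he ord0.
have := SC (e ord0); rewrite (rnorm_singular_vector s0 se).
by rewrite orthonormal_rnorm// !mulr1; apply: le_trans.
Qed.

Lemma singular_value_ge S n t : singular_value_bounds S n t ->
  t <= singular_value S n.
Proof. exact/ub_le_sup/has_ubound_singular_value_bounds. Qed.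

(** Half of the Courant-Fischer principle: the span of n + 1 orthonormal singular vectors with
    values at least t contains a unit vector x orthogonal to the n vectors [f], and |S x| >= t
    there. *)
Lemma singular_value_le S (n : nat) (f : 'I_n -> H) M : 0 <= M ->
  (forall x, (forall i, inner (f i) x = 0) -> rnorm (S x) <= M * rnorm x) ->
  singular_value S n <= M.
Proof.
move=> M0 fM; rewrite /singular_value -/(singular_value_bounds S n).
have [->|/set0P A0] := eqVneq (singular_value_bounds S n) set0; first by rewrite sup0.
apply: ge_sup => // t [e oe /choice[s se]].
have [t0|t0] := leP t 0; first exact: le_trans t0 M0.
have [c [x1 xf]] := exists_orthogonal f oe.
have := fM _ xf; rewrite x1 mulr1; apply: le_trans.
rewrite -(@ler_pXn2r _ 2) ?nnegrE ?rnorm_ge0 ?(ltW t0)//.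
rewrite (@rnorm_singular_lincomb _ _ _ s)//; last by move=> i; have [] := se i.
rewrite -[leLHS]mulr1 -(expr1n _ 2) -x1 rnorm_lincomb// mulr_sumr.
apply: ler_sum => i _; rewrite ler_wpM2r ?sqr_ge0//.
have [s0 ts _] := se i.
by rewrite ler_pXn2r// nnegrE (ltW t0).
Qed.

(** In directions orthogonal to [f] the identity is the first-order condition at the maximum; in the
    direction of some [f i] both sides vanish, because [f i] is itself a singular vector orthogonal
    to v. *)
Lemma maximizer_singular S (I : finType) (f : I -> H) (s : I -> R) v :
  orthonormal_system f -> (forall i, singular_vector S (s i) (f i)) ->
  rnorm v = 1 -> (forall i, inner (f i) v = 0) ->
  (forall u, (forall i, inner (f i) u = 0) ->
     rnorm (S u) <= rnorm (S v) * rnorm u) ->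
  singular_vector S (rnorm (S v)) v.
Proof.
move=> of_ sf v1 vf vmax y; set M := rnorm (S v).
have orth u : (forall i, inner (f i) u = 0) ->
    inner (S u) (S v) = inner u ((M ^+ 2)%:C *: v).
  move=> uf; apply/eqP; rewrite -subr_eq0 -oppr_eq0 opprB; apply/eqP.
  apply: (@quad_nonneg_linear0 _ (M ^+ 2 * rnorm u ^+ 2 - rnorm (S u) ^+ 2)) => z.
  have := vmax (v + z *: u); rewrite -/M => /(_ _)/wrap[].
    by move=> i; rewrite innerDr innerZr vf uf mulr0 addr0.
  rewrite -(@ler_pXn2r _ 2) ?nnegrE ?mulr_ge0 ?rnorm_ge0//.
  rewrite exprMn linearD linearZ /= addrC [v + _]addrC !rnorm_sqrD v1 !rnormZ -/M.
  rewrite !innerZl innerZr -subr_ge0 => h; apply: le_trans h _.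
  rewrite le_eqVlt; apply/orP; left; apply/eqP.
  rewrite [Num.conj z * (_ - _)]mulrBr Re_add Re_opp.
  by rewrite [Num.conj z * ((M ^+ 2)%:C * _)]mulrCA Re_mull; ring.
have -> : y = (y - \sum_i inner (f i) y *: f i) + \sum_i inner (f i) y *: f i.
  by rewrite subrK.
have := orth _ (residual_orth of_ y); move: (y - _) => y' oy'.
rewrite linearD !innerDl oy'; congr (_ + _).
rewrite linear_sum !inner_suml; apply: eq_bigr => i _.
have fv : inner (S (f i)) (S v) = 0.
  by rewrite inner_conj (sf i v) innerZr [inner v _]inner_conj vf rmorph0 mulr0 rmorph0.
by rewrite linearZ /= !innerZl innerZr vf fv !mulr0.
Qed.

(* The last clause makes [f] a list of top singular vectors. *)
Lemma exists_singular_system (h : nat -> H) S n :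
  orthonormal_system h -> compact_op S ->
  exists f : 'I_n -> H, [/\ orthonormal_system f,
    forall i : 'I_n, singular_vector S (singular_value S i) (f i) &
    forall x, (forall i, inner (f i) x = 0) ->
      forall i : 'I_n, rnorm (S x) <= singular_value S i * rnorm x].
Proof.
move=> oh cS.
(* A sequence constrained only below n lets the induction append a vector without recasting
   ordinals. *)
suff [f [of_ sf mf]] : exists f : nat -> H, [/\
    forall i j, (i < n)%N -> (j < n)%N -> inner (f i) (f j) = (i == j)%:R,
    forall i, (i < n)%N -> singular_vector S (singular_value S i) (f i) &
    forall x, (forall i, (i < n)%N -> inner (f i) x = 0) ->
      forall i, (i < n)%N -> rnorm (S x) <= singular_value S i * rnorm x].
  exists f; split => [i j|i|x xf i]; [exact: of_|exact: sf|].
  by apply: mf => // j jn; apply: (xf (Ordinal jn)).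
elim: n => [|n [f [of_ sf mf]]]; first by exists (fun=> 0).
pose g (i : 'I_n) := f i.
have og : orthonormal_system g by move=> i j; apply: of_.
have [|v [v1 vg vmax]] := @exists_maximizer _ _ _ g S cS.
  (* Here the infinite orthonormal system h enters: it provides a unit vector orthogonal to the n
     vectors found so far. *)
  have oh' : orthonormal_system (fun i : 'I_n.+1 => h i) by move=> i j; apply: oh.
  by have [c [x1 xg]] := exists_orthogonal g oh'; eexists; split; [exact: x1|].
have sv := maximizer_singular og (fun i => sf i (ltn_ord i)) v1 vg vmax.
set M := rnorm (S v) in vmax sv *.
have Ms i : (i < n)%N -> M <= singular_value S i.
  move=> i_n; have := mf v _ i i_n; rewrite v1 mulr1; apply=> j jn.
  exact: (vg (Ordinal jn)).
pose f' i := if (i < n)%N then f i else v.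
have of' i j : (i < n.+1)%N -> (j < n.+1)%N -> inner (f' i) (f' j) = (i == j)%:R.
  have vg' k : (k < n)%N -> inner (f k) v = 0 by move=> kn; exact: (vg (Ordinal kn)).
  rewrite /f' => i_n1 jn1; case: ltnP => i_n; case: ltnP => jn.
  - exact: of_.
  - by rewrite vg'// ltn_eqF// (leq_trans i_n).
  - by rewrite inner_conj vg'// rmorph0 gtn_eqF// (leq_trans jn).
  - have -> : i = j by lia.
    by rewrite eqxx innerE v1 expr1n.
(* The upper bound is Courant-Fischer with the first n vectors; for the lower one, the n + 1 vectors
   [f'] all have values at least M. *)
have Mn : singular_value S n = M.
  apply/eqP; rewrite eq_le (singular_value_le (f := g)) ?rnorm_ge0//=.
  apply: singular_value_ge; exists (fun i : 'I_n.+1 => f' i).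
    by move=> i j; apply: of'.
  move=> [i /= i_n]; rewrite /f'; case: ifPn => [i_n'|_].
    by exists (singular_value S i); split; [exact: singular_value_ge0|exact: Ms|exact: sf].
  by exists M; split => //; exact: rnorm_ge0.
have Ms' i : (i < n.+1)%N -> M <= singular_value S i.
  rewrite ltnS => i_n; have [/Ms//|ni] := ltnP i n.
  by have -> : i = n by [lia]; rewrite Mn.
exists f'; split => //.
- move=> i i_n1; rewrite /f'; case: ltnP => i_n; first exact: sf.
  by have -> : i = n by [lia]; rewrite Mn.
- move=> x xf i i_n; apply: le_trans (ler_wpM2r (rnorm_ge0 x) (Ms' i i_n)).
  apply: vmax => j; have := xf j; rewrite /f' ltn_ord; apply.
  by rewrite ltnS ltnW.
Qed.

End singular_systems.

(** * Positive operators and Ky Fan inequalities *)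

Section positive_operators.
Context (R : realType) (H : hilbertType R).
Implicit Types (S T : bop H).

Lemma singular_value_anti T m n : (m <= n)%N ->
  singular_value T n <= singular_value T m.
Proof.
move=> mn; rewrite [leLHS]/singular_value -/(singular_value_bounds T n).
have [->|/set0P A0] := eqVneq (singular_value_bounds T n) set0.
  by rewrite sup0 singular_value_ge0.
apply: ge_sup => // t [e oe he]; apply: singular_value_ge.
exists (e \o widen_ord (leq_ltn_trans mn (ltnSn n))) => [i j|i]; last exact: he.
exact: oe.
Qed.

(** The form of T is real at x + z y for every z, which makes z d real for the defect d; taking z =
    1 and z = i leaves only d = 0. *)
Lemma positive_hermitian T x y : positive_op T ->
  inner x (T y) = inner (T x) y.
Proof.
move=> pT; apply/eqP; rewrite -subr_eq0; apply/eqP.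
pose d := inner x (T y) - inner (T x) y; rewrite -/d.
have real_T u : inner (T u) u = inner u (T u).
  by rewrite inner_conj (ge0_complexE (pT u)) conj_real.
have key (z : R[i]) : z * d = Num.conj (z * d).
  have := real_T (x + z *: y).
  rewrite linearD linearZ /= !innerDl !innerDr !innerZl !innerZr !real_T => /eqP.
  rewrite -subr_eq0 => /eqP e0; apply/eqP; rewrite -subr_eq0; apply/eqP.
  rewrite rmorphM /= /d rmorphB /= -!inner_conj -[RHS]oppr0 -e0; ring.
have := key 1; rewrite !mul1r => d1.
have := key 'i%C; rewrite rmorphM /= -d1 => /eqP.
rewrite -subr_eq0 -mulrBl mulf_eq0 => /orP[|/eqP//].
rewrite eq_complex /= => /andP[_].
by rewrite opprK -mulr2n mulrn_eq0 oner_eq0.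
Qed.

(** Evaluate the form at x + z y, with z of modulus 1 turning the cross term <x, T y> into minus its
    modulus. *)
Lemma positive_amgm T x y : positive_op T ->
  2 * rnorm (inner x (T y)) <=
  complex.Re (inner x (T x)) + complex.Re (inner y (T y)).
Proof.
move=> pT; set c := inner x (T y).
have [->|c0] := eqVneq c 0.
  by rewrite rnorm0 mulr0 addr_ge0// ge0_Re.
have r0 : rnorm c != 0 by rewrite rnorm_eq0.
pose z := - (Num.conj c * (rnorm c)^-1%:C).
have z1 : Num.conj z * z = 1.
  rewrite mulrC -sqr_rnorm /z rnormN rnormM rnorm_real rnorm_conj.
  by rewrite ger0_norm ?invr_ge0 ?rnorm_ge0// mulfV// expr1n.
have := pT (x + z *: y).
rewrite linearD linearZ /= !innerDl !innerDr !innerZl !innerZr mulrA z1 mul1r.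
have -> : inner y (T x) = Num.conj c by rewrite positive_hermitian// inner_conj.
rewrite -rmorphM /= -/c [z * c]mulrC.
have -> : c * z = (- rnorm c)%:C.
  rewrite /z mulrN mulrA -sqr_rnorm -real_complexM real_complexN.
  by rewrite expr2 -mulrA mulfV// mulr1.
by rewrite conj_real => /ge0_Re; rewrite !Re_add /=; lra.
Qed.

End positive_operators.

Section ky_fan.
Context (R : realType) (H : hilbertType R).
Implicit Types (S T : bop H).

(** From (T + s)(T - s) x = 0 the vector w = T x - s x satisfies T w = -s w, and positivity of T
    forces w = 0 when s > 0. For s = 0 the norm of T x is 0 directly. *)
Lemma positive_singular_eigen T s x : positive_op T -> 0 <= s ->
  singular_vector T s x -> T x = s%:C *: x.
Proof.
move=> pT s0 sx; apply/eqP; rewrite -subr_eq0; set w := _ - _.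
have wE : T w = - (s%:C *: w).
  apply: inner_ext => y; rewrite /w linearB linearZ /= innerBr innerNr !innerZr innerBr innerZr.
  rewrite (positive_hermitian _ _ pT) sx innerZr real_complexM.
  by rewrite (positive_hermitian _ _ pT); ring.
have h := pT w; rewrite wE innerNr innerZr innerE -real_complexM oppr_ge0 in h.
have {}h : s * rnorm w ^+ 2 <= 0 by rewrite -lecR.
have [s1|s1] := eqVneq s 0.
  have := rnorm_singular_vector s0 sx; rewrite /w s1 mul0r scale0r subr0.
  by move/eqP; rewrite rnorm_eq0.
have sp : 0 < s by rewrite lt_neqAle eq_sym s1.
by move: h; rewrite pmulr_rle0// => h; rewrite -rnorm_eq0 -sqrf_eq0 eq_le h sqr_ge0.
Qed.

Lemma positive_expand T (I : finType) (f : I -> H) (s : I -> R) w (c : I -> R[i]) :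
  positive_op T -> orthonormal_system f -> (forall i, T (f i) = (s i)%:C *: f i) ->
  (forall i, inner (f i) w = 0) ->
  complex.Re (inner (w + \sum_i c i *: f i) (T (w + \sum_i c i *: f i))) =
  complex.Re (inner w (T w)) + \sum_i s i * rnorm (c i) ^+ 2.
Proof.
move=> pT of_ sf wf; set v := \sum_i _.
have Tv : T v = \sum_i (c i * (s i)%:C) *: f i.
  by rewrite linear_sum; apply: eq_bigr => i _; rewrite linearZ /= sf scalerA.
have wv : inner w (T v) = 0.
  rewrite Tv inner_sumr big1// => i _.
  by rewrite innerZr inner_conj wf rmorph0 mulr0.
rewrite linearD /= innerDl !innerDr wv addr0.
have -> : inner v (T w) = 0.
  by rewrite positive_hermitian// inner_conj wv rmorph0.
rewrite add0r Re_add; congr (_ + _).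
rewrite inner_suml Re_sum; apply: eq_bigr => i _.
rewrite innerZl Tv inner_lincomb// mulrA [_ * c i]mulrC -sqr_rnorm.
by rewrite -real_complexM /= mulrC.
Qed.

Context (h : nat -> H) (oh : orthonormal_system h).

Lemma positive_singular_system T n : positive_op T -> compact_op T ->
  exists f : 'I_n -> H, [/\ orthonormal_system f,
    forall i : 'I_n, T (f i) = (singular_value T i)%:C *: f i &
    forall x, (forall i, inner (f i) x = 0) -> forall i : 'I_n,
      complex.Re (inner x (T x)) <= singular_value T i * rnorm x ^+ 2].
Proof.
move=> pT cT; have [f [of_ sf mf]] := exists_singular_system n oh cT.
exists f; split => // [i|x xf i].
  by apply: positive_singular_eigen => //; exact: singular_value_ge0.
rewrite (le_trans (Re_le_rnorm _))// (le_trans (cauchy_schwarz _ _))//.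
rewrite expr2 mulrCA ler_wpM2l ?rnorm_ge0//.
exact: mf.
Qed.

(** With th the smallest of the first n singular values, T lies below th + sum_i (mu_i - th) f_i
    f_i^*. Summing the forms at the y_j, the constant th is paid for by the trace bound K n and each
    rank-one term by the operator bound K. *)
Lemma ky_fan_max T (n : nat) (J : finType) (y : J -> H) (K : R) :
  positive_op T -> compact_op T ->
  (forall x, \sum_j rnorm (inner (y j) x) ^+ 2 <= K * rnorm x ^+ 2) ->
  \sum_j rnorm (y j) ^+ 2 <= K * n%:R ->
  \sum_j complex.Re (inner (y j) (T (y j))) <=
  K * \sum_(i < n) singular_value T i.
Proof.
move=> pT cT yK yn; case: n yn => [|n] yn.
  rewrite big_ord0 mulr0 big1// => j _.
  have y0 : y j = 0.
    apply/eqP; rewrite -rnorm_eq0 -sqrf_eq0 eq_le sqr_ge0 andbT.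
    move: yn; rewrite mulr0; apply: le_trans.
    by rewrite (bigD1 j)//= lerDl sumr_ge0// => k _; rewrite sqr_ge0.
  by rewrite y0 inner0l.
have [f [of_ Tf mf]] := positive_singular_system n.+1 pT cT.
pose th := singular_value T n.
have th0 : 0 <= th by exact: singular_value_ge0.
have le_form x : complex.Re (inner x (T x)) <=
    \sum_(i < n.+1) (singular_value T i - th) * rnorm (inner (f i) x) ^+ 2 +
    th * rnorm x ^+ 2.
  have := positive_expand (w := x - \sum_i inner (f i) x *: f i)
    (fun i => inner (f i) x) pT of_ Tf (residual_orth of_ x).
  rewrite subrK => ->.
  have := mf _ (residual_orth of_ x) ord_max; rewrite -/th rnorm_residual//.
  under [X in _ -> _ <= X + _]eq_bigr do rewrite mulrBl.
  by rewrite sumrB -mulr_sumr /=; lra.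
apply: (@le_trans _ _ (\sum_j (\sum_(i < n.+1) (singular_value T i - th) *
    rnorm (inner (f i) (y j)) ^+ 2 + th * rnorm (y j) ^+ 2))).
  by apply: ler_sum => j _; exact: le_form.
rewrite big_split /= exchange_big /= -mulr_sumr.
have -> : K * (\sum_(i < n.+1) singular_value T i) =
    \sum_(i < n.+1) (singular_value T i - th) * K + th * (K * n.+1%:R).
  rewrite mulr_sumr; under [in RHS]eq_bigr do rewrite mulrBl.
  rewrite sumrB sumr_const card_ord -[th * K *+ _]mulr_natr -mulrA subrK.
  by apply: eq_bigr => i _; rewrite mulrC.
apply: lerD; last by rewrite ler_wpM2l.
apply: ler_sum => i _; rewrite -mulr_sumr ler_wpM2l//.
  by rewrite subr_ge0; apply: singular_value_anti; rewrite -ltnS.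
have := yK (f i); rewrite orthonormal_rnorm// expr1n mulr1; apply: le_trans.
by apply: ler_sum => j _; rewrite [inner (f i) _]inner_conj rnorm_conj.
Qed.

(* Here [\sum_m c m u_m u_m^*] is a positive operator below [T] of trace
   [\sum_m c m |u_m|^2]; the bound on [|u m|^2] is obtained by testing the
   hypothesis on the vector (T + e)^-1 (u m). *)
Lemma ky_fan_trace T (n : nat) (J : finType) (u : J -> H) (c : J -> R) :
  positive_op T -> compact_op T ->
  (forall x, \sum_m rnorm (inner (u m) x) ^+ 2 <= complex.Re (inner x (T x))) ->
  (forall m, 0 <= c m <= 1) -> \sum_m c m <= n%:R ->
  \sum_m c m * rnorm (u m) ^+ 2 <= \sum_(i < n) singular_value T i.
Proof.
move=> pT cT uT c01; case: n => [|n] cn.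
  rewrite big_ord0 big1// => m _; suff -> : c m = 0 by rewrite mul0r.
  apply/eqP; rewrite eq_le (andP (c01 m)).1 andbT (le_trans _ cn)//.
  by rewrite (bigD1 m)//= lerDl sumr_ge0// => k _; rewrite (andP (c01 k)).1.
have [f [of_ Tf mf]] := positive_singular_system n.+1 pT cT.
pose s i := singular_value T i; pose th := s n.
have s0 i : 0 <= s i by exact: singular_value_ge0.
apply/ler_addgt0Pr => e e0.
(* Singular values may vanish, so the inverses are regularized by [d]; the total cost (n + 1) d is
   [e]. *)
have [d d0 dE] : exists2 d, 0 < d & d * n.+1%:R = e.
  by exists (e / n.+1%:R); rewrite ?divr_gt0// mulfVK// pnatr_eq0.
have sd i : 0 < s i + d by rewrite ltr_wpDl.
pose b m (i : 'I_n.+1) := inner (f i) (u m).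
have u_le m : rnorm (u m) ^+ 2 <= th + d +
    \sum_(i < n.+1) (s i - th) / (s i + d) * rnorm (b m i) ^+ 2.
  pose w := u m - \sum_i b m i *: f i.
  have wf : forall i, inner (f i) w = 0 by exact: residual_orth.
  have wE : rnorm w ^+ 2 = rnorm (u m) ^+ 2 - \sum_i rnorm (b m i) ^+ 2.
    exact: rnorm_residual.
  have uE : u m = w + \sum_i b m i *: f i by rewrite /w subrK.
  (* On the span of [f] this is (T + d)^-1 applied to u m; on the complement, where only T <= s n is
     known, s n + d stands for T + d. For r = <u m, v> the hypothesis at v gives r^2 <= <v, T v> <=
     r, so r <= 1. *)
  pose v := (s n + d)^-1%:C *: w + \sum_(i < n.+1) ((s i + d)^-1%:C * b m i) *: f i.
  pose r := rnorm w ^+ 2 / (s n + d) + \sum_(i < n.+1) rnorm (b m i) ^+ 2 / (s i + d).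
  have uv : inner (u m) v = r%:C.
    have -> : inner (u m) v = (s n + d)^-1%:C * inner (u m) w +
        \sum_(i < n.+1) (s i + d)^-1%:C * b m i * inner (u m) (f i).
      rewrite /v innerDr innerZr inner_sumr; congr (_ + _).
      by apply: eq_bigr => i _; rewrite innerZr.
    rewrite /r real_complexD real_complex_sum; congr (_ + _).
      rewrite uE innerDl innerE inner_suml big1 ?addr0.
        by rewrite -real_complexM mulrC.
      by move=> i _; rewrite innerZl wf mulr0.
    apply: eq_bigr => i _; rewrite [inner (u m) _]inner_conj -/(b m i) -mulrA.
    by rewrite -sqr_rnorm -real_complexM mulrC.
  have vT : complex.Re (inner v (T v)) <= r.
    have wf' i : inner (f i) ((s n + d)^-1%:C *: w) = 0.
      by rewrite innerZr wf mulr0.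
    rewrite (positive_expand _ pT of_ Tf wf') /r; apply: lerD.
      rewrite linearZ /= innerZl innerZr conj_real !Re_mull.
      have := mf w wf ord_max; rewrite /= -/(s n) => wT.
      rewrite [leRHS]mulrC ler_wpM2l ?invr_ge0 ?(ltW (sd _))// ler_pdivrMl//.
      by apply: le_trans wT _; rewrite ler_wpM2r ?sqr_ge0// lerDl ltW.
    apply: ler_sum => i _; rewrite rnormM rnorm_real gtr0_norm ?invr_gt0//.
    rewrite exprMn mulrA [leRHS]mulrC ler_wpM2r ?sqr_ge0//.
    rewrite expr2 mulrA -[leRHS]mul1r ler_wpM2r ?invr_ge0 ?(ltW (sd _))//.
    by rewrite ler_pdivrMr// mul1r lerDl ltW.
  have r0 : 0 <= r.
    rewrite addr_ge0 ?divr_ge0 ?sqr_ge0 ?(ltW (sd _))// sumr_ge0// => i _.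
    by rewrite divr_ge0 ?sqr_ge0 ?(ltW (sd _)).
  have r1 : r <= 1.
    have : r ^+ 2 <= r.
      apply: le_trans vT; apply: le_trans (uT v); rewrite (bigD1 m)//= uv.
      rewrite rnorm_real ger0_norm// lerDl sumr_ge0// => k _.
      by rewrite sqr_ge0.
    by have [//|r1] := leP r 1; rewrite expr2; nra.
  have {r1} : rnorm w ^+ 2 <= (th + d) *
      (1 - \sum_(i < n.+1) rnorm (b m i) ^+ 2 / (s i + d)).
    by rewrite mulrC -ler_pdivrMr ?sd//; move: r1; rewrite /r; lra.
  rewrite wE lerBlDr => /le_trans; apply.
  rewrite mulrBr mulr1 -addrA lerD2l mulr_sumr addrC -sumrB.
  apply: ler_sum => i _; rewrite le_eqVlt; apply/orP; left; apply/eqP.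
  by field; rewrite gt_eqF.
apply: (@le_trans _ _ (\sum_m c m * (th + d +
    \sum_(i < n.+1) (s i - th) / (s i + d) * rnorm (b m i) ^+ 2))).
  by apply: ler_sum => m _; rewrite ler_wpM2l// (andP (c01 m)).1.
under eq_bigr do rewrite mulrDr mulr_sumr.
rewrite big_split /= -mulr_suml exchange_big /=.
apply: (@le_trans _ _ (n.+1%:R * (th + d) + \sum_(i < n.+1) (s i - th))).
  apply: lerD; first by rewrite ler_wpM2r// ltW// sd.
  apply: ler_sum => i _.
  have thi : 0 <= (s i - th) / (s i + d).
    rewrite divr_ge0 ?(ltW (sd _))// subr_ge0; apply: singular_value_anti.
    by rewrite -ltnS.
  apply: (@le_trans _ _ ((s i - th) / (s i + d) * \sum_m rnorm (b m i) ^+ 2)).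
    rewrite mulr_sumr; apply: ler_sum => m _; rewrite mulrCA ler_wpM2l//.
    by rewrite ler_piMl ?sqr_ge0// (andP (c01 m)).2.
  (* The hypothesis tested on the eigenvector [f i] bounds the sum of the |b m i|^2 by s i. *)
  apply: (@le_trans _ _ ((s i - th) / (s i + d) * s i)).
    rewrite ler_wpM2l//; have := uT (f i); rewrite Tf innerZr innerE.
    rewrite orthonormal_rnorm// expr1n mulr1 /=; apply: le_trans.
    by apply: ler_sum => m _; rewrite /b [inner (f i) _]inner_conj rnorm_conj.
  rewrite mulrAC ler_pdivrMr// ler_wpM2l//; last by rewrite lerDl ltW.
  by rewrite subr_ge0; apply: singular_value_anti; rewrite -ltnS.
rewrite sumrB sumr_const card_ord -[th *+ _]mulr_natr -dE.
by rewrite le_eqVlt; apply/orP; left; apply/eqP; rewrite /s; ring.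
Qed.

End ky_fan.

(** * Operators on a Hilbert basis *)

Section basis.
Context (R : realType) (H : hilbertType R).
Context (h : nat -> H) (oh : orthonormal_system h).
Implicit Types (S T B : bop H) (x y : H).

Lemma orthonormal_ord n : orthonormal_system (fun i : 'I_n => h i).
Proof. by move=> i j; apply: oh. Qed.

Lemma inner_psum (c : nat -> R[i]) n m : (m < n)%N ->
  inner (h m) (\sum_(i < n) c i *: h i) = c m.
Proof. by move=> mn; have := inner_lincomb (@orthonormal_ord n) c (Ordinal mn). Qed.

Lemma rnorm_psumB (c : nat -> R[i]) m n : (m <= n)%N ->
  rnorm (\sum_(i < n) c i *: h i - \sum_(i < m) c i *: h i) ^+ 2 =
  \sum_(i < n) rnorm (c i) ^+ 2 - \sum_(i < m) rnorm (c i) ^+ 2.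
Proof.
move=> mn; set x := \sum_(i < n) _.
have := rnorm_residual (@orthonormal_ord m) x.
have xi (i : 'I_m) : inner (h i) x = c i by rewrite inner_psum// (leq_trans (ltn_ord i)).
rewrite (eq_bigr (fun i : 'I_m => c i *: h i)); last by move=> i _; rewrite xi.
move=> ->; rewrite (rnorm_lincomb (@orthonormal_ord n)).
by congr (_ - _); apply: eq_bigr => i _; rewrite xi.
Qed.

Lemma riesz_fischer (c : nat -> R[i]) (K : R) :
  (forall n, \sum_(i < n) rnorm (c i) ^+ 2 <= K) ->
  exists x, (forall m, inner (h m) x = c m) /\
    tends (fun n => \sum_(i < n) c i *: h i) x.
Proof.
move=> cK; pose r n := \sum_(i < n) rnorm (c i) ^+ 2.
have r_nd : nondecreasing_seq r.
  apply/nondecreasing_seqP => n; rewrite /r big_ord_recr /= lerDl.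
  exact: sqr_ge0.
have /cvg_ex[l rl] : cvgn r.
  by apply: nondecreasing_is_cvgn => //; exists K => _ [n _ <-]; exact: cK.
have [|x ux] := @cauchy_tends _ _ (fun n => \sum_(i < n) c i *: h i).
  move=> e e0; have e2 : 0 < e ^+ 2 / 2 by rewrite divr_gt0// exprn_gt0.
  move/cvgrPdist_lt: rl => /(_ _ e2)[N _ rN]; exists N.
  have key m n : (N <= m)%N -> (m <= n)%N ->
      rnorm (\sum_(i < n) c i *: h i - \sum_(i < m) c i *: h i) < e.
    move=> Nm mn; rewrite -(@ltr_pXn2r _ 2) ?nnegrE ?rnorm_ge0 ?(ltW e0)//.
    rewrite rnorm_psumB// -/(r n) -/(r m).
    have := rN m Nm; have := rN n (leq_trans Nm mn).
    by rewrite /= !ltr_norml => /andP[? ?] /andP[? ?]; lra.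
  move=> m n Nm Nn; have [mn|nm] := leqP m n; first by rewrite rnorm_sub key.
  by rewrite key// ltnW.
exists x; split => // m; apply/eqP; rewrite -subr_eq0 -rnorm_eq0.
apply/eqP/le_anti; rewrite rnorm_ge0 andbT; apply/ler_addgt0Pr => e e0.
have [N uN] := tends_inner (h m) ux e0; rewrite add0r.
have := uN _ (leq_maxl N m.+1); rewrite inner_psum; last by rewrite leq_max leqnn orbT.
by rewrite rnorm_sub => /ltW.
Qed.

Lemma tends_rnorm_le (u : nat -> H) x (K : R) : tends u x ->
  (forall n, rnorm (u n) <= K) -> rnorm x <= K.
Proof.
move=> ux uK; apply/ler_addgt0Pr => e e0; have [N /(_ _ (leqnn _)) uN] := ux e e0.
have := rnormD (x - u N) (u N); rewrite subrK rnorm_sub.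
by have := uK N; lra.
Qed.

Lemma exists_bop (F : H -> H) (M : R) : linear F ->
  (forall x, rnorm (F x) <= M * rnorm x) -> exists B : bop H, forall x, B x = F x.
Proof.
move=> lF FM; have bF : F \in bounded_operator (R := R) (H := H).
  rewrite inE /=; split => //; exists M => x.
  by rewrite !normE -real_complexM lecR.
by exists (Bop bF).
Qed.

Context (ch : complete_system h).

Lemma basis_ext x y : (forall m, inner (h m) x = inner (h m) y) -> x = y.
Proof.
move=> xy; apply/eqP; rewrite -subr_eq0; apply/eqP/ch => m.
by rewrite innerBr xy subrr.
Qed.

Lemma basis_expand x : tends (fun n => \sum_(i < n) inner (h i) x *: h i) x.
Proof.
have [n|y [yx]] := @riesz_fischer (fun i => inner (h i) x) (rnorm x ^+ 2).
  exact: (bessel (@orthonormal_ord n)).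
by rewrite (basis_ext yx).
Qed.

Lemma inner_basis_ext y (c : nat -> R[i]) (K : R) :
  (forall n, \sum_(i < n) rnorm (c i) ^+ 2 <= K ^+ 2) -> 0 <= K ->
  (forall m, inner (h m) y = c m) -> rnorm y <= K.
Proof.
move=> cK K0 yc; apply: (tends_rnorm_le (basis_expand y)) => n.
rewrite -(@ler_pXn2r _ 2) ?nnegrE ?rnorm_ge0//.
rewrite (rnorm_lincomb (@orthonormal_ord n)); apply: le_trans (cK n).
by under eq_bigr do rewrite yc.
Qed.

(** The image of x is built from its coefficients <B h_m, x>. They are square-summable because a
    truncation y satisfies |y|^2 = <B y, x> <= M |y| |x|. The adjoint relation is checked on partial
    sums of the second argument and passes to the limit. *)
Lemma exists_adjoint B :
  exists B' : bop H, forall x y, inner (B' x) y = inner x (B y).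
Proof.
have [M M0 BM] := bop_bound B.
have bound x n : \sum_(i < n) rnorm (inner (B (h i)) x) ^+ 2 <= (M * rnorm x) ^+ 2.
  pose y := \sum_(i < n) inner (B (h i)) x *: h i.
  rewrite -(rnorm_lincomb (@orthonormal_ord n)) -/y ler_pXn2r ?nnegrE ?mulr_ge0 ?rnorm_ge0//.
  have yy : rnorm y ^+ 2 <= M * rnorm y * rnorm x.
    have -> : rnorm y ^+ 2 = complex.Re (inner (B y) x).
      rewrite (rnorm_lincomb (@orthonormal_ord n)).
      have -> : inner (B y) x = \sum_(i < n) (rnorm (inner (B (h i)) x) ^+ 2)%:C.
        rewrite /y linear_sum inner_suml; apply: eq_bigr => i _.
        by rewrite linearZ /= innerZl sqr_rnorm mulrC.
      by rewrite -real_complex_sum.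
    rewrite (le_trans (Re_le_rnorm _))// (le_trans (cauchy_schwarz _ _))//.
    by rewrite ler_wpM2r ?rnorm_ge0.
  have [->|y0] := eqVneq (rnorm y) 0; first by rewrite mulr_ge0 ?rnorm_ge0.
  have yp : 0 < rnorm y by rewrite lt_neqAle eq_sym y0 rnorm_ge0.
  by rewrite -(ler_pM2l yp) -expr2 (le_trans yy)// mulrCA mulrA.
have /choice[F FP] : forall x, exists z, forall m, inner (h m) z = inner (B (h m)) x.
  by move=> x; have [z [zx _]] := riesz_fischer (c := fun m => inner (B (h m)) x) (bound x);
    exists z.
have [|x|B' BE] := @exists_bop F M.
- move=> c x y; apply: basis_ext => m.
  by rewrite innerDr innerZr !FP innerDr innerZr.
- by apply: inner_basis_ext (bound x) _ (FP x); rewrite mulr_ge0 ?rnorm_ge0.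
exists B' => x y; rewrite BE; apply/eqP; rewrite -subr_eq0 -rnorm_eq0.
apply/eqP/le_anti; rewrite rnorm_ge0 andbT; apply/ler_addgt0Pr => e e0.
have e2 : 0 < e / 2 by rewrite divr_gt0.
have [N uN] := tends_inner (F x) (basis_expand y) e2.
have [N' uN'] := tends_inner x (tends_bop B (basis_expand y)) e2.
have := uN _ (leq_maxl N N'); have := uN' _ (leq_maxr N N').
set z := \sum_(i < _) _; rewrite /= -/z.
have -> : inner (F x) z = inner x (B z).
  rewrite linear_sum !inner_sumr; apply: eq_bigr => i _.
  by rewrite linearZ /= !innerZr [LHS]mulrC [RHS]mulrC inner_conj FP -inner_conj.
have := rnormB (inner x (B z) - inner x (B y)) (inner x (B z) - inner (F x) y).
rewrite add0r; set a := inner x (B z).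
have -> : a - inner x (B y) - (a - inner (F x) y) = inner (F x) y - inner x (B y) by ring.
by lra.
Qed.

Definition adjoint B : bop H := projT1 (cid (exists_adjoint B)).

Lemma adjointP B x y : inner (adjoint B x) y = inner x (B y).
Proof. by rewrite /adjoint; case: cid. Qed.

Lemma exists_diagonal (a : linf R) : exists D : bop H,
  forall m x, inner (h m) (D x) = a m * inner (h m) x.
Proof.
have [M aM] := linf_bounded a.
have {}aM n : rnorm (a n) <= M by have := aM n; rewrite normE lecR.
have M0 : 0 <= M by apply: le_trans (aM 0); exact: rnorm_ge0.
have bound x n : \sum_(i < n) rnorm (a i * inner (h i) x) ^+ 2 <= (M * rnorm x) ^+ 2.
  rewrite exprMn; apply: le_trans (ler_wpM2l (sqr_ge0 M) (bessel (@orthonormal_ord n) x)).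
  rewrite mulr_sumr; apply: ler_sum => i _.
  by rewrite rnormM exprMn ler_wpM2r ?sqr_ge0// ler_pXn2r ?nnegrE ?rnorm_ge0.
have /choice[F FP] : forall x, exists z, forall m, inner (h m) z = a m * inner (h m) x.
  by move=> x; have [z [zx _]] := riesz_fischer (c := fun m => a m * inner (h m) x) (bound x);
    exists z.
have [|x|D DE] := @exists_bop F M.
- move=> c x y; apply: basis_ext => m.
  by rewrite innerDr innerZr !FP innerDr innerZr; ring.
- by apply: inner_basis_ext (bound x) _ (FP x); rewrite mulr_ge0 ?rnorm_ge0.
by exists D => m x; rewrite DE.
Qed.

Definition diagonal_op (a : linf R) : bop H := projT1 (cid (exists_diagonal a)).

Lemma diagonal_opP a m x : inner (h m) (diagonal_op a x) = a m * inner (h m) x.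
Proof. by rewrite /diagonal_op; case: cid. Qed.

Lemma bop_ext S T : (forall x, S x = T x) -> S = T.
Proof. by move=> ST; apply/val_inj/funext. Qed.

Lemma diagonal_op_linear (c : R[i]) a b :
  diagonal_op (c *: a + b) = c *: diagonal_op a + diagonal_op b.
Proof.
apply: bop_ext => x; apply: basis_ext => m.
by rewrite diagonal_opP /= !fctE innerDr innerZr !diagonal_opP mulrDl mulrA.
Qed.

Lemma diagonal_op_one x : diagonal_op (linf_one R) x = x.
Proof. by apply: basis_ext => m; rewrite diagonal_opP mul1r. Qed.

Definition diagonal_for T (d : nat -> R) : Prop :=
  forall m x, inner (h m) (T x) = (d m)%:C * inner (h m) x.

Lemma diagonal_form_lim T d x (e : R) : diagonal_for T d -> 0 < e ->
  exists N, forall n, (N <= n)%N ->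
    rnorm ((\sum_(i < n) d i * rnorm (inner (h i) x) ^+ 2)%:C - inner x (T x)) < e.
Proof.
move=> Td e0; have [N uN] := tends_inner (T x) (basis_expand x) e0.
exists N => n Nn; apply: le_lt_trans (uN n Nn).
have -> : (\sum_(i < n) d i * rnorm (inner (h i) x) ^+ 2)%:C =
    Num.conj (inner (T x) (\sum_(i < n) inner (h i) x *: h i)).
  rewrite -inner_conj inner_suml real_complex_sum; apply: eq_bigr => i _.
  by rewrite innerZl Td [RHS]mulrCA [Num.conj _ * _]mulrC -sqr_rnorm [LHS]real_complexM.
by rewrite [inner x _]inner_conj -rmorphB rnorm_conj.
Qed.

Lemma diagonal_psum_le T d x n : (forall m, 0 <= d m) -> diagonal_for T d ->
  \sum_(i < n) d i * rnorm (inner (h i) x) ^+ 2 <= complex.Re (inner x (T x)).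
Proof.
move=> d0 Td; apply/ler_addgt0Pr => e e0; have [N uN] := diagonal_form_lim x Td e0.
have := uN _ (leq_maxl N n); move/(le_lt_trans (Re_le_rnorm _)).
rewrite Re_add Re_opp /=; set A := \sum_(i < maxn N n) _.
suff : \sum_(i < n) d i * rnorm (inner (h i) x) ^+ 2 <= A by lra.
have nd : nondecreasing_seq (fun n => \sum_(i < n) d i * rnorm (inner (h i) x) ^+ 2).
  apply/nondecreasing_seqP => k; rewrite big_ord_recr /= lerDl.
  by rewrite mulr_ge0// sqr_ge0.
by apply: nd; rewrite leq_maxr.
Qed.

Lemma diagonal_for_positive T d : (forall m, 0 <= d m) -> diagonal_for T d ->
  positive_op T.
Proof.
move=> d0 Td x; rewrite lecE /= (le_trans _ (diagonal_psum_le x 0 d0 Td)); last first.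
  by rewrite big_ord0.
(* The order of R[i] also asks for a zero imaginary part, and the form is a limit of real partial
   sums. *)
rewrite andbT; apply/eqP/normr0_eq0/le_anti; rewrite normr_ge0 andbT.
apply/ler_addgt0Pr => e e0; have [N /(_ _ (leqnn _))] := diagonal_form_lim x Td e0.
rewrite add0r => /ltW; apply: le_trans; rewrite -lecR -normE.
by apply: le_trans (normc_ge_Im _); rewrite lecR; case: (inner x (T x)) => p q /=;
  rewrite sub0r normrN.
Qed.

End basis.

(** * Schur's majorization of diagonals, and membership in the weak ideal *)

Section schur.
Context (R : realType) (H : hilbertType R).
Context (h : nat -> H) (oh : orthonormal_system h) (ch : complete_system h).
Implicit Types (S T B D : bop H) (x y : H).

(** For top singular vectors f_i the sum of the <f_i, D f_i> is sum_m c_m d_m with c_m = sum_i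
    |<h_m, f_i>|^2, which are weights in [0, 1] of total at most n. Quantifying over such weights
    replaces a decreasing rearrangement of [d]. *)
Lemma diagonal_singular_sum_le D (d : nat -> R) n K :
  compact_op D -> (forall m, 0 <= d m) -> diagonal_for h D d ->
  (forall N (c : 'I_N -> R), (forall m, 0 <= c m <= 1) -> \sum_m c m <= n%:R ->
     \sum_m c m * d m <= K) ->
  \sum_(i < n) singular_value D i <= K.
Proof.
move=> cD d0 Dd dK; have pD := diagonal_for_positive oh ch d0 Dd.
have [f [of_ Df _]] := positive_singular_system oh n pD cD.
apply/ler_addgt0Pr => e e0.
(* Each of the n forms loses at most [r] by truncation of the basis; n + 1 also covers n = 0. *)
have [r r0 rE] : exists2 r, 0 < r & r * n.+1%:R = e.
  by exists (e / n.+1%:R); rewrite ?divr_gt0// mulfVK// pnatr_eq0.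
have /choice[N NP] := fun i => diagonal_form_lim oh ch (f i) Dd r0.
pose N' := \max_i N i.
pose c (m : 'I_N') := \sum_(i < n) rnorm (inner (h m) (f i)) ^+ 2.
have := dK N' c; have c01 m : 0 <= c m <= 1.
  rewrite sumr_ge0 => [|i _]; last exact: sqr_ge0.
  have := bessel of_ (h m); rewrite orthonormal_rnorm// expr1n; apply: le_trans.
  by apply: ler_sum => i _; rewrite inner_conj rnorm_conj.
move=> /(_ c01); have -> : \sum_m c m <= n%:R.
  rewrite /c exchange_big /=; apply: (@le_trans _ _ (\sum_(i < n) 1)).
    apply: ler_sum => i _; have := bessel (orthonormal_ord oh (n := N')) (f i).
    by rewrite (orthonormal_rnorm _ of_) expr1n.
  by rewrite sumr_const card_ord.
move=> /(_ isT) cK; apply: (@le_trans _ _ (\sum_m c m * d m + n%:R * r)); last first.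
  by rewrite lerD// -rE mulrC ler_wpM2l ?(ltW r0)// ler_nat.
have -> : \sum_m c m * d m = \sum_(i < n) \sum_(m < N') d m * rnorm (inner (h m) (f i)) ^+ 2.
  rewrite exchange_big; apply: eq_bigr => m _; rewrite mulr_suml.
  by apply: eq_bigr => i _; rewrite mulrC.
have -> : n%:R * r = \sum_(i < n) r by rewrite sumr_const card_ord mulr_natl.
rewrite -big_split; apply: ler_sum => i _ /=.
have := NP i N' (leq_bigmax i); rewrite Df innerZr innerE.
rewrite (orthonormal_rnorm _ of_) expr1n mulr1 rnorm_sub => /(le_lt_trans (Re_le_rnorm _)).
by rewrite Re_add Re_opp /=; lra.
Qed.

(** The vectors u_m = sqrt(l_m) B h_m satisfy sum_m u_m u_m^* <= B T B^*, because <u_m, x> =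
    sqrt(l_m) <h_m, B^* x>, and |u_m|^2 is the m-th entry of D. So [ky_fan_trace] bounds every
    weighted sum required by [diagonal_singular_sum_le]. *)
Lemma schur_trace_ineq T (l : nat -> R) B D n :
  compact_op T -> (forall m, 0 <= l m) -> diagonal_for h T l ->
  compact_op D -> diagonal_for h D (fun m => l m * rnorm (B (h m)) ^+ 2) ->
  \sum_(i < n) singular_value D i <=
  \sum_(i < n) singular_value (bop_comp B (bop_comp T (adjoint oh ch B))) i.
Proof.
move=> cT l0 Tl cD Dl; set S := bop_comp B _.
have pT := diagonal_for_positive oh ch l0 Tl.
have SE x : inner x (S x) = inner (adjoint oh ch B x) (T (adjoint oh ch B x)).
  by rewrite adjointP.
have pS : positive_op S by move=> x; rewrite SE.
have cS : compact_op S by apply/compact_op_compl/compact_op_compr.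
apply: (diagonal_singular_sum_le cD _ Dl) => [m|N c c01 cn].
  by rewrite mulr_ge0// sqr_ge0.
have := @ky_fan_trace _ _ h oh S n 'I_N (fun m => (Num.sqrt (l m))%:C *: B (h m)) c pS cS.
have sq m : rnorm ((Num.sqrt (l m))%:C : R[i]) ^+ 2 = l m.
  by rewrite rnorm_real ger0_norm ?sqrtr_ge0// sqr_sqrtr.
move=> /(_ _ c01 cn)/wrap[].
  move=> x; rewrite SE; apply: le_trans (diagonal_psum_le oh ch _ N l0 Tl).
  rewrite le_eqVlt; apply/orP; left; apply/eqP; apply: eq_bigr => m _.
  rewrite innerZl conj_real rnormM exprMn sq; congr (_ * _ ^+ 2).
  by rewrite [in RHS]inner_conj adjointP -inner_conj.
apply: le_trans; rewrite le_eqVlt; apply/orP; left; apply/eqP.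
by apply: eq_bigr => m _; rewrite rnormZ exprMn sq.
Qed.

Lemma weakL1_of_le S T (K : R) : 0 <= K -> compact_op S -> weakL1 T ->
  (forall n, \sum_(i < n) singular_value S i <= K * \sum_(i < n) singular_value T i) ->
  weakL1 S.
Proof.
move=> K0 cS [_ [M TM]] ST; split => //; exists (K * M) => _ [n _ <-].
apply: (@le_trans _ _ (K * gamma_seq T n)).
  rewrite /gamma_seq mulrCA ler_wpM2l ?ST// invr_ge0 ln_ge0// ler1n//.
by rewrite ler_wpM2l//; apply: TM; exists n.
Qed.

(* A substitute for a bound on the partial sums of the singular values of [S],
   which is obviously stable under sums. *)
Definition dominated T S (K : R) : Prop :=
  forall n (x y : 'I_n -> H), orthonormal_system x ->
  (forall z, \sum_j rnorm (inner (y j) z) ^+ 2 <= rnorm z ^+ 2) ->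
  \sum_j rnorm (inner (y j) (S (x j))) <= K * \sum_(i < n) singular_value T i.

Lemma bessel_rnorm_le1 n (y : 'I_n -> H) j :
  (forall z, \sum_j rnorm (inner (y j) z) ^+ 2 <= rnorm z ^+ 2) ->
  rnorm (y j) <= 1.
Proof.
move=> yB; have := yB (y j); rewrite (bigD1 j)//= innerE rnorm_real.
set s := \sum_(i < n | _) _; have s0 : 0 <= s.
  by apply: sumr_ge0 => i _; rewrite sqr_ge0.
have := rnorm_ge0 (y j); set r := rnorm _ => r0.
rewrite ger0_norm ?exprn_ge0// => h1; have [//|r1] := leP r 1.
have : r ^+ 2 < (r ^+ 2) ^+ 2.
  by rewrite -[ltLHS]mulr1 [ltRHS]expr2 ltr_pM2l ?exprn_gt0 ?exprn_egt1//
    (lt_trans ltr01).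
by lra.
Qed.

(** Write <y, A T C x> = <A^* y, T C x> and bound it by the mean of the forms of T at A^* y and C x.
    Each of the two sums falls under [ky_fan_max]: applying B to a Bessel family gives operator
    bound |B^*|^2 and trace bound n |B|^2, hence the maxima of squares. *)
Lemma dominated_comp T A C : positive_op T -> compact_op T ->
  exists2 K, 0 <= K & dominated T (bop_comp A (bop_comp T C)) K.
Proof.
move=> pT cT; have [M M0 AM] := bop_bound A; have [L L0 CL] := bop_bound C.
have [M' M'0 AM'] := bop_bound (adjoint oh ch A).
have [L' L'0 CL'] := bop_bound (adjoint oh ch C).
pose K := Num.max (M ^+ 2) (M' ^+ 2); pose K' := Num.max (L ^+ 2) (L' ^+ 2).
exists ((K + K') / 2); first by rewrite divr_ge0// addr_ge0// le_max sqr_ge0.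
have KF (B : bop H) (r r' : R) n (y : 'I_n -> H) : 0 <= r -> 0 <= r' ->
    (forall x, rnorm (B x) <= r * rnorm x) ->
    (forall x, rnorm (adjoint oh ch B x) <= r' * rnorm x) ->
    (forall z, \sum_j rnorm (inner (y j) z) ^+ 2 <= rnorm z ^+ 2) ->
    \sum_j complex.Re (inner (B (y j)) (T (B (y j)))) <=
    Num.max (r ^+ 2) (r' ^+ 2) * \sum_(i < n) singular_value T i.
  move=> r0 r'0 Br Br' yB; apply: (ky_fan_max oh (y := fun j => B (y j)) pT cT).
  - move=> x; apply: (@le_trans _ _ (r' ^+ 2 * rnorm x ^+ 2)); last first.
      by rewrite ler_wpM2r ?sqr_ge0// le_max lexx orbT.
    rewrite -exprMn; apply: (@le_trans _ _ (rnorm (adjoint oh ch B x) ^+ 2)).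
      apply: le_trans (yB _); rewrite le_eqVlt; apply/orP; left; apply/eqP.
      apply: eq_bigr => j _; congr (_ ^+ 2).
      by rewrite inner_conj -(adjointP oh ch) -inner_conj.
    by rewrite ler_pXn2r ?nnegrE ?mulr_ge0 ?rnorm_ge0.
  - apply: (@le_trans _ _ (\sum_(j < n) r ^+ 2)).
      apply: ler_sum => j _; rewrite ler_pXn2r ?nnegrE ?rnorm_ge0//.
      apply: le_trans (Br _) _; rewrite -[leRHS]mulr1 ler_wpM2l//.
      exact: bessel_rnorm_le1.
    by rewrite sumr_const card_ord -[leLHS]mulr_natr ler_wpM2r// le_max lexx.
move=> n x y ox yB.
have xB z : \sum_j rnorm (inner (x j) z) ^+ 2 <= rnorm z ^+ 2 by exact: bessel.
have AadjK z : rnorm (adjoint oh ch (adjoint oh ch A) z) <= M * rnorm z.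
  suff -> : adjoint oh ch (adjoint oh ch A) z = A z by [].
  by apply: inner_ext => w; rewrite inner_conj adjointP -inner_conj adjointP.
have h1 := KF (adjoint oh ch A) M' M n y M'0 M0 AM' AadjK yB.
have h2 := KF C L L' n x L0 L'0 CL CL' xB.
apply: (@le_trans _ _ ((
  \sum_j complex.Re (inner (adjoint oh ch A (y j)) (T (adjoint oh ch A (y j)))) +
  \sum_j complex.Re (inner (C (x j)) (T (C (x j))))) / 2)); last first.
  by move: h1; rewrite maxC -/K => h1; move: h2; rewrite -/K' => h2; lra.
rewrite -big_split /= mulr_suml; apply: ler_sum => j _.
have := positive_amgm (adjoint oh ch A (y j)) (C (x j)) pT.
by rewrite adjointP; lra.
Qed.

Lemma dominated_add T S S' K K' : dominated T S K -> dominated T S' K' ->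
  dominated T (S + S') (K + K').
Proof.
move=> TS TS' n x y ox yB; rewrite mulrDl.
apply: le_trans (lerD (TS n x y ox yB) (TS' n x y ox yB)).
by rewrite -big_split; apply: ler_sum => j _; rewrite innerDr rnormD.
Qed.

Lemma dominated_scale T S K (c : R[i]) : dominated T S K ->
  dominated T (c *: S) (rnorm c * K).
Proof.
move=> TS n x y ox yB; rewrite -mulrA.
apply: le_trans (ler_wpM2l (rnorm_ge0 c) (TS n x y ox yB)).
by rewrite mulr_sumr; apply: ler_sum => j _; rewrite innerZr rnormM.
Qed.

(** Test domination on singular vectors x_j of S and their normalized images y_j, so that <y_j, S
    x_j> = mu_j. The family y is Bessel: p = sum_j <y_j, z> y_j satisfies |p|^2 = <p, z> <= |p|
    |z|. *)
Lemma dominated_weakL1 T S K : 0 <= K -> weakL1 T -> compact_op S ->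
  dominated T S K -> weakL1 S.
Proof.
move=> K0 wT cS TS; apply: (weakL1_of_le K0 cS wT) => n.
have [x [ox sx _]] := exists_singular_system n oh cS.
(* Since the inverse of 0 is 0, [y j] is 0 when the singular value vanishes. *)
pose y j := (singular_value S (j : 'I_n))^-1%:C *: S (x j).
have s0 (j : 'I_n) : 0 <= singular_value S j by exact: singular_value_ge0.
have Sx j : rnorm (S (x j)) = singular_value S j.
  by rewrite (rnorm_singular_vector (s0 j))// orthonormal_rnorm// mulr1.
apply: le_trans (TS n x y ox _) => [|z].
  apply: ler_sum => j _; rewrite innerZl conj_real innerE rnormM !rnorm_real Sx.
  rewrite !ger0_norm ?invr_ge0 ?sqr_ge0 ?s0//.
  have [->|sj] := eqVneq (singular_value S j) 0; first by rewrite expr0n mulr0.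
  by rewrite expr2 mulrA mulVf// mul1r.
pose c j := (singular_value S (j : 'I_n))^-1%:C * inner (y j) z.
pose p := \sum_j inner (y j) z *: y j.
have pE : p = S (\sum_j c j *: x j).
  rewrite linear_sum; apply: eq_bigr => j _.
  by rewrite [RHS]linearZ /= /c mulrC -scalerA.
have pB : rnorm p ^+ 2 = \sum_j rnorm (inner (y j) z) ^+ 2.
  rewrite pE (rnorm_singular_lincomb _ ox sx); apply: eq_bigr => j _.
  have [s1|sj] := eqVneq (singular_value S j) 0.
    by rewrite /c /y s1 invr0 mul0r rnorm0 scale0r inner0l rnorm0 expr0n !mulr0.
  rewrite /c rnormM exprMn mulrA rnorm_real ger0_norm ?invr_ge0 ?s0//.
  by rewrite -exprMn mulfV// expr1n mul1r.
have pz : inner p z = (rnorm p ^+ 2)%:C.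
  rewrite pB inner_suml real_complex_sum; apply: eq_bigr => j _.
  by rewrite innerZl sqr_rnorm mulrC.
rewrite -pB ler_pXn2r ?nnegrE ?rnorm_ge0//.
have := cauchy_schwarz p z; rewrite pz rnorm_real ger0_norm ?sqr_ge0//.
have [->|p0] := eqVneq (rnorm p) 0; first by rewrite rnorm_ge0.
by rewrite expr2 ler_pM2l// lt_neqAle eq_sym p0 rnorm_ge0.
Qed.

End schur.

(** * Generalised limits *)

Section states.
Context (R : realType).
Implicit Types (a b : linf R) (xi : linf R -> R[i]).

Lemma exists_linf (u : nat -> R[i]) (K : R) : (forall n, rnorm (u n) <= K) ->
  exists a : linf R, forall n, a n = u n.
Proof.
move=> uK; have bu : (u : nat -> R[i]^o) \in bounded_seq (R := R).
  by rewrite inE /=; exists K => n; rewrite normE lecR.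
by exists (Linf bu).
Qed.

Lemma linf_ext a b : (forall n, a n = b n) -> a = b.
Proof. by move=> ab; apply/val_inj/funext. Qed.

Lemma linf_rnorm_bound a : exists2 M : R, 0 <= M & forall n, rnorm (a n : R[i]) <= M.
Proof.
have [M aM] := linf_bounded a; have {}aM n : rnorm (a n : R[i]) <= M.
  by have := aM n; rewrite normE lecR.
by exists M => //; apply: le_trans (aM 0); exact: rnorm_ge0.
Qed.

Lemma linfDE a b n : (a + b) n = a n + b n. Proof. by []. Qed.
Lemma linfNE a n : (- a) n = - a n. Proof. by []. Qed.
Lemma linfZE c a n : (c *: a) n = c * a n. Proof. by []. Qed.
Lemma linf_oneE n : linf_one R n = 1. Proof. by []. Qed.
Definition linfE := (linfDE, linfNE, linfZE, linf_oneE).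

Lemma state0 xi : linf_state xi -> xi 0 = 0.
Proof.
by move=> [lin _ _]; have := lin (-1) 0 0; rewrite scaler0 addr0 mulN1r addNr.
Qed.

Lemma stateD xi a b : linf_state xi -> xi (a + b) = xi a + xi b.
Proof. by move=> [lin _ _]; have := lin 1 a b; rewrite scale1r mul1r. Qed.

Lemma stateZ xi c a : linf_state xi -> xi (c *: a) = c * xi a.
Proof.
by move=> sxi; have [lin _ _] := sxi; rewrite -[c *: a]addr0 lin (state0 sxi) addr0.
Qed.

Lemma stateB xi a b : linf_state xi -> xi (a - b) = xi a - xi b.
Proof. by move=> sxi; rewrite stateD// -scaleN1r stateZ// mulN1r. Qed.

Lemma state_le xi a b : linf_state xi -> (forall n, 0 <= a n - b n) -> xi b <= xi a.
Proof. by move=> sxi ab; have [_ pos _] := sxi; rewrite -subr_ge0 -stateB// pos. Qed.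

Lemma abs_Re_le (z : R[i]) : `|complex.Re z| <= rnorm z.
Proof. by rewrite -lecR -normE; exact: normc_ge_Re. Qed.

Lemma bounded_Re a : bounded_fun (fun n => complex.Re (a n)).
Proof.
have [M M0 aM] := linf_rnorm_bound a.
exists M; split; first exact: num_real.
move=> r /ltW Mr n _ /=; apply: le_trans Mr.
by apply: le_trans (aM n); exact: abs_Re_le.
Qed.

Lemma limn_sup_le (u : R^nat) (e : R) N : bounded_fun u ->
  (forall n, (N <= n)%N -> u n <= e) -> limn_sup u <= e.
Proof.
move=> bu ue; rewrite limn_supE//; apply: (@le_trans _ _ (sups u N)).
  by apply: ge_inf; [exact: bounded_fun_has_lbound_sups|exists N].
apply: ge_sup; first by exists (u N), N => /=.
by move=> _ [n /= Nn <-]; apply: ue.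
Qed.

Lemma le_limn_sup (u : R^nat) x : bounded_fun u ->
  (forall c N, (forall n, (N <= n)%N -> u n <= c) -> x <= c) -> x <= limn_sup u.
Proof.
move=> bu ux; rewrite limn_supE//; apply: lb_le_inf; first by exists (sups u 0), 0%N.
move=> _ [N _ <-]; apply: (ux _ N) => n Nn; apply: ub_le_sup; last by exists n.
exact/has_ubound_sdrop/bounded_fun_has_ubound.
Qed.

Lemma limn_inf_le (u : R^nat) x : bounded_fun u ->
  (forall c N, (forall n, (N <= n)%N -> c <= u n) -> c <= x) -> limn_inf u <= x.
Proof.
move=> bu ux; rewrite limn_infE//; apply: ge_sup; first by exists (infs u 0), 0%N.
move=> _ [N _ <-]; apply: (ux _ N) => n Nn; apply: ge_inf; last by exists n.
exact/has_lbound_sdrop/bounded_fun_has_lbound.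
Qed.

Lemma generalised_limit_vanishing xi a : generalised_limit xi ->
  (forall n, 0 <= a n) ->
  (forall e : R, 0 < e -> exists N, forall n, (N <= n)%N -> complex.Re (a n) <= e) ->
  xi a = 0.
Proof.
move=> [[_ pos _] gl] a0 alim; rewrite (ge0_complexE (pos a a0)).
congr (_%:C); apply/le_anti; rewrite ge0_Re ?pos// andbT.
apply/ler_addgt0Pr => e e0; rewrite add0r; have [N aN] := alim e e0.
have /andP[_] := gl a a0; rewrite (ge0_complexE (pos a a0)) lecR => /le_trans; apply.
exact: limn_sup_le (bounded_Re a) aN.
Qed.

(** If a >= c from index N on, adding a finitely supported b >= 0 makes a + b >= c everywhere
    without changing the value of xi; dually for upper bounds. *)
Lemma state_generalised_limit xi : linf_state xi ->
  (forall b N, (forall n, 0 <= b n) -> (forall n, (N <= n)%N -> b n = 0) -> xi b = 0) ->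
  generalised_limit xi.
Proof.
move=> sxi xi_fin; split => // a a0.
have [lin pos one] := sxi; rewrite (ge0_complexE (pos a a0)) !lecR.
have aE n : a n = (complex.Re (a n))%:C by exact: ge0_complexE.
have [M M0 aM] := linf_rnorm_bound a.
have xic (c : R) : xi (c%:C *: linf_one R) = c%:C by rewrite stateZ// one mulr1.
(* The sign [s] selects the positive part of c - a ([true], lower bounds) or of a - c ([false],
   upper bounds), cut off at N. *)
have trunc (c : R) (s : bool) N : exists2 b : linf R, xi b = 0 & forall n,
    b n = if (n < N)%N then (Num.max 0 ((-1) ^+ s * (complex.Re (a n) - c)))%:C else 0.
  have [|b bE] := @exists_linf (fun n => if (n < N)%N then
      (Num.max 0 ((-1) ^+ s * (complex.Re (a n) - c)))%:C else 0) (M + `|c|).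
    move=> n; case: ifP => _; last by rewrite rnorm0 addr_ge0.
    rewrite rnorm_real ger0_norm ?le_max ?lexx// ge_max addr_ge0//=.
    apply: le_trans (ler_norm _) _; rewrite normrM normrX normrN1 expr1n mul1r.
    apply: le_trans (ler_normB _ _) _; rewrite lerD2r.
    by apply: le_trans (abs_Re_le _) (aM n).
  exists b => //; apply: (xi_fin _ N) => n; rewrite bE; last by rewrite ltnNge => ->.
  by case: ifP => // _; rewrite ler0c le_max lexx.
apply/andP; split.
- apply: limn_inf_le (bounded_Re a) _ => c N ca.
  have [b b0 bE] := trunc c true N.
  have : xi (c%:C *: linf_one R) <= xi (a + b).
    apply: state_le => // n; rewrite !linfE bE aE mulr1.
    case: ltnP => [_|Nn]; last by rewrite addr0 -real_complexB ler0c subr_ge0 ca.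
    rewrite -real_complexD -real_complexB ler0c expr1 mulN1r opprB.
    by rewrite subr_ge0 -lerBlDl le_max lexx orbT.
  by rewrite xic stateD// b0 addr0 (ge0_complexE (pos a a0)) lecR.
- apply: le_limn_sup (bounded_Re a) _ => c N ca.
  have [b b0 bE] := trunc c false N.
  have : xi a <= xi (c%:C *: linf_one R + b).
    apply: state_le => // n; rewrite !linfE bE aE mulr1.
    case: ltnP => [_|Nn]; last by rewrite addr0 -real_complexB ler0c subr_ge0 ca.
    rewrite -real_complexD -real_complexB ler0c expr0 mul1r.
    by rewrite subr_ge0 -lerBlDl le_max lexx orbT.
  by rewrite stateD// xic b0 addr0 (ge0_complexE (pos a a0)) lecR.
Qed.

End states.

(** * The trace of [A T] depends only on the diagonal of [A] *)

(** Along each real line the expression is affine and nonnegative, hence constant, so its linear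
    part vanishes for every z; z = 1 and z = i then separate a from b. *)
Lemma affine_nonneg_linear0 (R : realType) (q a b : R[i]) :
  (forall z, 0 <= q + Num.conj z * a + z * b) -> a = 0.
Proof.
move=> qab.
have f0 z : Num.conj z * a + z * b = 0.
  set f := _ + _.
  have key (t : R) : 0 <= q + t%:C * f.
    have := qab (t%:C * z); rewrite rmorphM /= conj_real.
    by rewrite /f mulrDr !mulrA addrA.
  have q0 := key 0; rewrite mul0r addr0 in q0.
  have fE : f = (complex.Re f)%:C.
    have := key 1; rewrite mul1r => qf; rewrite RRe_real//.
    rewrite -[f](addKr q) addrC; apply: rpredB; apply: ger0_real => //.
  have {}key t : 0 <= complex.Re q + t * complex.Re f.
    by have := ge0_Re (key t); rewrite Re_add Re_mull.
  rewrite fE; congr (_%:C); apply/eqP/negPn/negP => r0.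
  (* At this parameter the affine function takes the value -1. *)
  have := key (- (complex.Re q + 1) / complex.Re f).
  by rewrite mulfVK//; lra.
have h1 := f0 1; have h2 := f0 'i%C.
rewrite rmorph1 !mul1r in h1.
have ci : Num.conj ('i%C : R[i]) = - 'i%C.
  by apply/eqP; rewrite eq_complex /= oppr0 !eqxx.
have i0 : ('i%C : R[i]) != 0 by rewrite eq_complex /= oner_eq0 andbF.
move: h2; rewrite ci mulNr => /eqP; rewrite addrC subr_eq0 => /eqP/(mulfI i0) ba.
move: h1; rewrite ba => /eqP; rewrite -mulr2n -[_ *+ 2]mulr_natl mulf_eq0.
by rewrite pnatr_eq0 => /orP[//|/eqP].
Qed.

Section diagonal_trace.
Context (R : realType) (H : hilbertType R).
Context (h : nat -> H) (oh : orthonormal_system h) (ch : complete_system h).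
Context (T : bop H) (pT : positive_op T) (wT : weakL1 T).
Context (eig : forall m, eigenvector T (h m)).
Context (w : linf R -> R[i]) (gw : generalised_limit w).
Context (tau : bop H -> R[i]) (tau_ext : linear_extension w tau).
Implicit Types (A B C S : bop H) (a b : linf R).

Let l m := complex.Re (inner (h m) (T (h m))).

Local Notation mult := (diagonal_op oh ch).
Local Notation "A ** B" := (bop_comp A B) (at level 40, left associativity).

Lemma bopDE A B x : (A + B) x = A x + B x. Proof. by []. Qed.
Lemma bopZE c A x : (c *: A) x = c *: A x. Proof. by []. Qed.

Lemma eigenvalue_ge0 m : 0 <= l m.
Proof. exact/ge0_Re/pT. Qed.

Lemma eigenbasis_diagonal : diagonal_for h T l.
Proof.
move=> m x; rewrite positive_hermitian//; have [_ [c Tc]] := eig m.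
have cE : c = (l m)%:C.
  have := pT (h m); rewrite /l Tc innerZr oh eqxx mulr1 => c0.
  by rewrite -ge0_complexE.
by rewrite Tc innerZl cE conj_real.
Qed.

Let cT : compact_op T := wT.1.

(** A class inside [weakL1] which contains all A T C and is closed under linear combinations, so
    that [tau] can be expanded on it. *)
Definition subordinate S : Prop :=
  compact_op S /\ exists2 K, 0 <= K & dominated T S K.

Lemma subordinate_weakL1 S : subordinate S -> weakL1 S.
Proof. by move=> [cS [K K0 TS]]; apply: dominated_weakL1 cS TS. Qed.

Lemma subordinate_comp A C : subordinate (A ** (T ** C)).
Proof.
split; first exact/compact_op_compl/compact_op_compr.
exact: dominated_comp.
Qed.

Lemma subordinate_compl A : subordinate (A ** T).
Proof.
have -> : A ** T = A ** (T ** mult (linf_one R)).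
  by apply: bop_ext => x; rewrite /= diagonal_op_one.
exact: subordinate_comp.
Qed.

Lemma subordinate_compr C : subordinate (T ** C).
Proof.
have -> : T ** C = mult (linf_one R) ** (T ** C).
  by apply: bop_ext => x; rewrite /= diagonal_op_one.
exact: subordinate_comp.
Qed.

Lemma subordinate_add S S' : subordinate S -> subordinate S' -> subordinate (S + S').
Proof.
move=> [cS [K K0 SK]] [cS' [K' K'0 SK']]; split; first exact: compact_op_add.
by exists (K + K'); [exact: addr_ge0|exact: dominated_add].
Qed.

Lemma subordinate_scale c S : subordinate S -> subordinate (c *: S).
Proof.
move=> [cS [K K0 SK]]; split; first exact: compact_op_scale.
by exists (rnorm c * K); [rewrite mulr_ge0 ?rnorm_ge0|exact: dominated_scale].
Qed.

Lemma tauP c S S' : subordinate S -> subordinate S' ->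
  tau (c *: S + S') = c * tau S + tau S'.
Proof. by move=> *; apply: tau_ext.1; exact: subordinate_weakL1. Qed.

Lemma tau_ge0 S : subordinate S -> positive_op S -> 0 <= tau S.
Proof.
move=> /subordinate_weakL1 wS pS; rewrite (tau_ext.2 _ wS pS).
have [[_ pos _] _] := gw; apply: pos => n /=; rewrite ler0c.
by rewrite mulr_ge0 ?invr_ge0 ?ln_ge0 ?ler1n// sumr_ge0// => j _;
  rewrite singular_value_ge0.
Qed.

Lemma tau_le S S' : subordinate S -> positive_op S -> subordinate S' -> positive_op S' ->
  (forall n, \sum_(i < n) singular_value S i <= \sum_(i < n) singular_value S' i) ->
  tau S <= tau S'.
Proof.
move=> /subordinate_weakL1 wS pS /subordinate_weakL1 wS' pS' SS'.
rewrite (tau_ext.2 _ wS pS) (tau_ext.2 _ wS' pS').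
apply: (state_le gw.1) => n /=; rewrite -real_complexB ler0c subr_ge0.
by rewrite ler_wpM2l ?SS'// invr_ge0 ln_ge0// ler1n.
Qed.

Lemma mult_diagonal a (d : nat -> R) : (forall m, a m = (d m)%:C) ->
  diagonal_for h (mult a ** T) (fun m => l m * d m).
Proof.
move=> ad m x; rewrite diagonal_opP ad eigenbasis_diagonal mulrA.
by rewrite -[(d m)%:C * _]real_complexM [d m * _]mulrC.
Qed.

Lemma mult_positive a : (forall m, 0 <= a m) -> positive_op (mult a ** T).
Proof.
move=> a0; apply: (diagonal_for_positive oh ch (d := fun m => l m * complex.Re (a m))).
  by move=> m; rewrite mulr_ge0 ?eigenvalue_ge0 ?ge0_Re.
by apply: mult_diagonal => m; exact: ge0_complexE.
Qed.

Lemma tau_mult c a b :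
  tau (mult (c *: a + b) ** T) = c * tau (mult a ** T) + tau (mult b ** T).
Proof.
rewrite -tauP; [|exact: subordinate_compl..].
by congr (tau _); apply: bop_ext => x; rewrite /= diagonal_op_linear.
Qed.

Lemma adjoint_add A z : forall x,
  adjoint oh ch (A + z *: mult (linf_one R)) x = adjoint oh ch A x + Num.conj z *: x.
Proof.
move=> x; apply: inner_ext => y; rewrite inner_conj adjointP bopDE bopZE.
rewrite diagonal_op_one innerDr innerZr rmorphD rmorphM /=.
by rewrite innerDr innerZr -!inner_conj [inner y (adjoint _ _ _ _)]inner_conj adjointP -inner_conj.
Qed.

(* The form B |-> tau (B T B^* ) - tau (M T), with M the multiplication by the
   diagonal of B^*B, is nonnegative and vanishes at the identity, so that its
   polarization vanishes at all pairs [A], 1. *)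
Lemma trace_diagonal A : tau (A ** T) = tau (mult (diagonal_seq oh A) ** T).
Proof.
set a := diagonal_seq oh A.
have [M M0 AM] := bop_bound A; have [K K0 aK] := linf_rnorm_bound a.
have [|q qE] := @exists_linf R (fun m => (rnorm (A (h m)) ^+ 2)%:C) (M ^+ 2).
  move=> m; rewrite rnorm_real ger0_norm ?sqr_ge0// ler_pXn2r ?nnegrE ?rnorm_ge0//.
  by apply: le_trans (AM _) _; rewrite orthonormal_rnorm// mulr1.
have [|ac acE] := @exists_linf R (fun m => Num.conj (a m)) K.
  by move=> m; rewrite rnorm_conj aK.
pose A' := adjoint oh ch A.
apply/eqP; rewrite -subr_eq0; apply/eqP.
(* With B = A + z, both tau (B T B^* ) and the trace of the multiplication by the |B h_m|^2 contain
   |z|^2 tau T. Their difference is thus affine in z, and its coefficient of conj z is the quantity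
   to be shown zero. *)
apply: (@affine_nonneg_linear0 _ (tau (A ** (T ** A')) - tau (mult q ** T)) _
  (tau (T ** A') - tau (mult ac ** T))) => z.
pose B := A + z *: mult (linf_one R).
pose P := B ** (T ** adjoint oh ch B).
have BE x : B x = A x + z *: x.
  by rewrite /B bopDE bopZE diagonal_op_one.
have PE : P = Num.conj z *: (A ** T) + (z *: (T ** A') +
    ((z * Num.conj z) *: T + A ** (T ** A'))).
  apply: bop_ext => x; have -> : P x = B (T (adjoint oh ch B x)) by [].
  rewrite BE adjoint_add -/A' !bopDE !bopZE /=.
  rewrite !linearD !linearZ /= !scalerA [X in X + _]addrC -!addrA.
  by rewrite [z * _]mulrC; congr (_ + _); rewrite addrC -!addrA.
pose d := Num.conj z *: a + (z *: ac + ((z * Num.conj z) *: linf_one R + q)).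
have dE m : d m = (rnorm (B (h m)) ^+ 2)%:C.
  rewrite !linfE acE qE -!innerE BE !innerDl !innerDr !innerZl !innerZr.
  by rewrite [inner (A (h m)) (h m)]inner_conj oh eqxx mulr1 /a /=; ring.
have sT : subordinate T.
  have <- : mult (linf_one R) ** T = T by apply: bop_ext => x; rewrite /= diagonal_op_one.
  exact: subordinate_compl.
have tauT : tau (mult (linf_one R) ** T) = tau T.
  by congr tau; apply: bop_ext => x; rewrite /= diagonal_op_one.
have sP : subordinate P by exact: subordinate_comp.
have sATA : subordinate (A ** (T ** A')) by exact: subordinate_comp.
have sTA : subordinate (T ** A') by exact: subordinate_compr.
have sAT : subordinate (A ** T) by exact: subordinate_compl.
have tauPE : tau P = Num.conj z * tau (A ** T) + (z * tau (T ** A') +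
    ((z * Num.conj z) * tau T + tau (A ** (T ** A')))).
  have s1 : subordinate ((z * Num.conj z) *: T + A ** (T ** A')).
    by apply: subordinate_add => //; exact: subordinate_scale.
  have s2 : subordinate (z *: (T ** A') + ((z * Num.conj z) *: T + A ** (T ** A'))).
    by apply: subordinate_add => //; exact: subordinate_scale.
  by rewrite PE !tauP.
have tauDE : tau (mult d ** T) = Num.conj z * tau (mult a ** T) +
    (z * tau (mult ac ** T) + ((z * Num.conj z) * tau T + tau (mult q ** T))).
  by rewrite !tau_mult tauT.
have : tau (mult d ** T) <= tau P.
  apply: tau_le => //.
  - exact: subordinate_compl.
  - by apply: mult_positive => m; rewrite dE ler0c sqr_ge0.
  - move=> x; have -> : P x = B (T (adjoint oh ch B x)) by [].
    by rewrite -(adjointP oh ch); apply: pT.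
  - move=> n; apply: (@schur_trace_ineq _ _ _ oh ch T l B (mult d ** T) n) => //.
    + exact: eigenvalue_ge0.
    + exact: eigenbasis_diagonal.
    + exact: compact_op_compl.
    + exact: mult_diagonal.
by rewrite -subr_ge0 tauPE tauDE; congr (0 <= _); ring.
Qed.

Lemma trace_finite_support b N : (forall m, 0 <= b m) ->
  (forall m, (N <= m)%N -> b m = 0) -> tau (mult b ** T) = 0.
Proof.
move=> b0 bN; have sD := subordinate_compl (mult b).
have wD := subordinate_weakL1 sD; have pD := mult_positive b0.
rewrite (tau_ext.2 _ wD pD).
pose d m := l m * complex.Re (b m).
have d0 m : 0 <= d m by rewrite mulr_ge0 ?eigenvalue_ge0 ?ge0_Re.
have dN m : (N <= m)%N -> d m = 0 by move=> Nm; rewrite /d bN// mulr0.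
pose K := \sum_(m < N) d m.
have K0 : 0 <= K by exact: sumr_ge0.
have sumK n : \sum_(i < n) singular_value (mult b ** T) i <= K.
  apply: (diagonal_singular_sum_le oh ch sD.1 d0).
    by apply: mult_diagonal => m; exact: ge0_complexE.
  move=> N' c c01 _; apply: (@le_trans _ _ (\sum_(m < N') d m)).
    by apply: ler_sum => m _; rewrite ler_piMl// (andP (c01 m)).2.
  rewrite -(big_mkord xpredT d) /K -(big_mkord xpredT d).
  have [NN|NN] := leqP N' N.
    by rewrite [leRHS](big_cat_nat (leq0n _) NN)//= lerDl sumr_ge0.
  rewrite [leLHS](big_cat_nat (leq0n _) (ltnW NN))//= [X in _ + X](_ : _ = 0) ?addr0//.
  rewrite big_nat_cond big1//.
  by move=> m /andP[/andP[Nm _] _]; rewrite dN.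
apply: (generalised_limit_vanishing gw) => [n|e e0] /=.
  rewrite ler0c mulr_ge0 ?invr_ge0 ?ln_ge0 ?ler1n// sumr_ge0// => j _.
  exact: singular_value_ge0.
(* Beyond exp (K / e) the logarithm exceeds K / e, so K divided by it is at most e. *)
pose X := expR (K / e); exists (Num.bound X) => n Xn.
have X0 : 0 < X by exact: expR_gt0.
have nX : X <= n.+2%:R.
  apply: le_trans (ltW (archi_boundP (ltW X0))) _.
  by rewrite ler_nat (leq_trans Xn)// -addn2 leq_addr.
rewrite /gamma_seq -/(\sum_(j < n.+1) _).
have ln0 : 0 < ln n.+2%:R :> R by rewrite ln_gt0// ltr1n.
rewrite ler_pdivrMl// (le_trans (sumK _))// -ler_pdivrMr//.
by rewrite -(expRK (K / e)) ler_ln ?posrE.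
Qed.

Lemma diagonal_generalised_limit : 0 < tau T ->
  exists L : linf R -> R[i], generalised_limit L /\
    forall A, tau (A ** T) / tau T = L (diagonal_seq oh A).
Proof.
move=> tau0; exists (fun a => tau (mult a ** T) / tau T); split; last first.
  by move=> A; rewrite trace_diagonal.
apply: state_generalised_limit => [|b N b0 bN]; last first.
  by rewrite (trace_finite_support b0 bN) mul0r.
split=> [c a b|a a0|].
- by rewrite tau_mult mulrDl mulrA.
- rewrite divr_ge0 ?(ltW tau0)//; apply: tau_ge0; first exact: subordinate_compl.
  exact: mult_positive.
- have -> : mult (linf_one R) ** T = T.
    by apply: bop_ext => x; rewrite /= diagonal_op_one.
  by rewrite divff// gt_eqF.
Qed.

End diagonal_trace.

(** * The image of Banach limits under [calL] *)

Section clip.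
Context (R : realType).
Implicit Types (x y p q r : R).

(* The length of [p, q] `&` ]-oo, x], for [p <= q]. *)
Definition clip p q x : R := Num.max 0 (x - p) - Num.max 0 (x - q).

Lemma clip_mono p q x y : p <= q -> x <= y -> clip p q x <= clip p q y.
Proof.
rewrite /clip => pq xy; rewrite !maxEle.
by case: ifP => h1; case: ifP => h2; case: ifP => h3; case: ifP => h4; lra.
Qed.

Lemma clip_left p q x : x <= p -> p <= q -> clip p q x = 0.
Proof.
move=> xp pq; rewrite /clip !(elimT max_idPl) ?subr0 ?subr_le0//.
exact: le_trans pq.
Qed.

Lemma clip_right p q x : q <= x -> p <= q -> clip p q x = q - p.
Proof.
move=> xq pq; rewrite /clip !(elimT max_idPr) ?subr_ge0//; first by ring.
exact: le_trans xq.
Qed.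

Lemma lebesgue_measure_clip p q x y : p <= q -> x <= y ->
  lebesgue_measure (`[p, q[%classic `&` `[x, y]%classic : set R) =
  (clip p q y - clip p q x)%:E.
Proof.
move=> pq xy.
have max_diff (s t : R) : (if (s%:E < t%:E)%E then (t%:E - s%:E)%E else 0%E) =
    (Num.max 0 (t - s))%:E.
  rewrite lte_fin; case: ltP => st; first by rewrite (elimT max_idPr)// subr_ge0 ltW.
  by rewrite (elimT max_idPl)// subr_le0.
have [qy|yq] := leP q y.
  have -> : `[p, q[%classic `&` `[x, y]%classic = `[Num.max p x, q[%classic :> set R.
    apply/seteqP; split => t /=; rewrite !in_itv/= ge_max.
      by move=> [/andP[-> ->] /andP[-> _]].
    by move=> /andP[/andP[-> ->] tq]; rewrite tq (le_trans (ltW tq)).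
  rewrite lebesgue_measure_itv/= max_diff (clip_right qy pq); congr EFin.
  have [xp|px] := leP x p.
    by rewrite (clip_left xp pq) subr0 (elimT max_idPr)// subr_ge0.
  have [xq|qx] := leP x q.
    by rewrite /clip (elimT max_idPr) ?subr_ge0// (elimT max_idPr (ltW _)) ?subr_gt0//
      (elimT max_idPl) ?subr_le0//; ring.
  by rewrite (clip_right (ltW qx) pq) subrr (elimT max_idPl)// subr_le0 ltW.
have -> : `[p, q[%classic `&` `[x, y]%classic = `[Num.max p x, y]%classic :> set R.
  apply/seteqP; split => t /=; rewrite !in_itv/= ge_max.
    by move=> [/andP[-> _] /andP[-> ->]].
  by move=> /andP[/andP[-> ->] tq]; rewrite tq (le_lt_trans tq).
rewrite lebesgue_measure_itv/= max_diff; congr EFin.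
have clipE z : z <= y -> clip p q z = Num.max 0 (z - p).
  by move=> zy; rewrite /clip [Num.max 0 (z - q)](elimT max_idPl) ?subr0// subr_le0
    (le_trans zy)// ltW.
rewrite !clipE//; have [xp|px] := leP x p.
  by rewrite [Num.max 0 (x - p)](elimT max_idPl) ?subr_le0// subr0.
rewrite !(elimT max_idPr) ?subr_ge0 ?(ltW px) ?(le_trans (ltW px))//.
by ring.
Qed.

Lemma Rintegral_indic_itv p q x y r : p <= q -> x <= y ->
  \int[lebesgue_measure]_(t in `[x, y]) (r * \1_(`[p, q[%classic : set R) t) =
  r * (clip p q y - clip p q x).
Proof.
move=> pq xy; rewrite RintegralZl//; last first.
  by apply: (integrableS measurableT) => //; exact: integrable_indic_itv.
by congr (_ * _); rewrite /Rintegral integral_indic//= lebesgue_measure_clip.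
Qed.

Lemma integrable_step p q x y r : lebesgue_measure.-integrable `[x, y]
  (EFin \o (fun t => r * \1_(`[p, q[%classic : set R) t)).
Proof.
rewrite (_ : _ \o _ = fun t => (r%:E * (\1_(`[p, q[%classic : set R) t)%:E)%E)//.
apply: integrableZl => //; apply: (integrableS measurableT) => //.
exact: integrable_indic_itv.
Qed.

Lemma Rintegral_step_sum M (c p q : nat -> R) x y :
  (forall m, p m <= q m) -> x <= y ->
  \int[lebesgue_measure]_(t in `[x, y])
    (\sum_(m < M) c m * \1_(`[p m, q m[%classic : set R) t) =
  \sum_(m < M) c m * (clip (p m) (q m) y - clip (p m) (q m) x).
Proof.
move=> pq xy; rewrite /Rintegral.
under eq_integral do rewrite -sumEFin.
rewrite integral_sum//; last by move=> m; exact: integrable_step.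
rewrite (eq_bigr (fun m : 'I_M => (c m * (clip (p m) (q m) y - clip (p m) (q m) x))%:E)).
  by rewrite sumEFin.
move=> m _; rewrite -Rintegral_indic_itv// /Rintegral fineK//.
apply: integrable_fin_num => //; exact: integrable_step.
Qed.

End clip.

Section log_clip.
Context (R : realType).
Implicit Types (x y : R) (m n M : nat).

(* The length of {t <= x : m + 1 <= e^t < m + 2}. *)
Definition log_clip m x : R := clip (ln m.+1%:R) (ln m.+2%:R) x.

Lemma ln_nat_le m n : (m <= n)%N -> ln m.+1%:R <= ln n.+1%:R :> R.
Proof. by move=> mn; rewrite ler_ln ?posrE// ler_nat. Qed.

Lemma ln_nat_ge0 m : 0 <= ln m.+1%:R :> R.
Proof. by rewrite ln_ge0// ler1n. Qed.

Lemma log_clip_mono m x y : x <= y -> log_clip m x <= log_clip m y.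
Proof. by apply: clip_mono; exact: ln_nat_le. Qed.

Lemma log_clip_left m x : x <= ln m.+1%:R -> log_clip m x = 0.
Proof. by move=> xm; apply: clip_left => //; exact: ln_nat_le. Qed.

Lemma log_clip_right m x : ln m.+2%:R <= x ->
  log_clip m x = ln m.+2%:R - ln m.+1%:R.
Proof. by move=> xm; apply: clip_right => //; exact: ln_nat_le. Qed.

(** The intervals [ln (m + 1), ln (m + 2)[ with m < M tile [0, ln (M + 1)[, and the sum
    telescopes. *)
Lemma sum_log_clip M x : x <= ln M.+1%:R ->
  \sum_(m < M) log_clip m x = Num.max 0 x.
Proof.
move=> xM; pose f m := - Num.max 0 (x - ln m.+1%:R).
rewrite -(big_mkord xpredT (fun m => log_clip m x)) (@telescope_sumr_eq _ _ _ f)//.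
  rewrite /f ln1 subr0 opprK [X in - X](elimT max_idPl) ?subr_le0//.
  by rewrite oppr0 add0r.
by move=> m _; rewrite /f /log_clip /clip; ring.
Qed.

Lemma exists_ln_bound x : exists M, x < ln M.+1%:R.
Proof.
exists (Num.bound (expR x)); rewrite -[ltLHS]expRK ltr_ln ?posrE ?expR_gt0//.
apply: lt_le_trans (archi_boundP (expR_ge0 x)) _.
by rewrite ler_nat.
Qed.

Lemma p_map_expR (a : nat -> R[i]) M t : t < ln M.+1%:R ->
  p_map a (expR t) =
  \sum_(m < M) a m * (\1_(`[ln m.+1%:R, ln m.+2%:R[%classic : set R) t : R)%:C.
Proof.
move=> tM.
have ind m : (expR t \in (`[m.+1%:R, m.+2%:R[%classic : set R)) =
    (t \in (`[ln m.+1%:R, ln m.+2%:R[%classic : set R)).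
  apply/idP/idP; rewrite !inE /= !in_itv /=.
    rewrite -[m.+1%:R in X in X -> _]lnK ?posrE// -[m.+2%:R in X in X -> _]lnK ?posrE//.
    by rewrite ler_expR ltr_expR.
  rewrite -[m.+1%:R in X in _ -> X]lnK ?posrE// -[m.+2%:R in X in _ -> X]lnK ?posrE//.
  by rewrite ler_expR ltr_expR.
rewrite /p_map -(@fsbig_widen _ _ _ _ `I_M setT)//.
  rewrite -(fsbig_ord _ _ (fun m => a m * \1_(`[m.+1%:R, m.+2%:R[%classic : set R) (expR t))).
  apply: eq_bigr => m _; rewrite !indicE ind.
  by case: (_ \in _).
move=> m [_ /= /negP]; rewrite -leqNgt => Mm; rewrite indicE ind.
rewrite (_ : (_ \in _) = false) ?mulr0//; apply/negbTE/negP.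
rewrite inE /= in_itv /= => /andP[mt _].
by have := le_lt_trans mt tM; rewrite ltNge ln_nat_le.
Qed.

Lemma E_mapE (a : nat -> R[i]) M n : n.+1%:R < ln M.+1%:R :> R ->
  E_map (Linv_map (p_map a)) n =
  \sum_(m < M) a m * (log_clip m n.+1%:R - log_clip m n%:R)%:C.
Proof.
move=> nM; rewrite /E_map /complex_integral /Linv_map.
have tM t : t \in (`[n%:R, n.+1%:R]%classic : set R) -> t < ln M.+1%:R.
  by rewrite inE /= in_itv /= => /andP[_ tn]; exact: le_lt_trans nM.
have nn : n%:R <= n.+1%:R :> R by rewrite ler_nat.
(* Real and imaginary parts are integrated at once, as additive maps that commute with real
   scalars. *)
have part (f : R[i] -> R) : (forall z (x : R), f (z * x%:C) = f z * x) ->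
    (forall F : 'I_M -> R[i], f (\sum_(m < M) F m) = \sum_(m < M) f (F m)) ->
    \int[lebesgue_measure]_(t in `[n%:R, n.+1%:R]) f (p_map a (expR t)) =
    f (\sum_(m < M) a m * (log_clip m n.+1%:R - log_clip m n%:R)%:C).
  move=> fM fS; rewrite fS (eq_bigr (fun m : 'I_M => f (a m) *
      (clip (ln m.+1%:R) (ln m.+2%:R) n.+1%:R - clip (ln m.+1%:R) (ln m.+2%:R) n%:R))).
    rewrite -(@Rintegral_step_sum _ M (f \o a) (fun m => ln m.+1%:R) (fun m => ln m.+2%:R))//.
      apply: eq_Rintegral => t /tM tM'; rewrite (p_map_expR _ tM') fS.
      by apply: eq_bigr => m _; rewrite fM.
    by move=> m; exact: ln_nat_le.
  by move=> m _; rewrite fM.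
have ImM (z : R[i]) (x : R) : complex.Im (z * x%:C) = complex.Im z * x.
  by case: z => p q /=; rewrite mulr0 add0r.
have ImS (F : 'I_M -> R[i]) : complex.Im (\sum_(m < M) F m) = \sum_(m < M) complex.Im (F m).
  by elim/big_rec2: _ => // i y x _ <-; case: (F i) x => p q [p' q'].
rewrite (part (@complex.Re R) (@Re_mulr R) (@Re_sum R _ _ _)) (part (@complex.Im R) ImM ImS).
by case: (\sum_(m < M) _).
Qed.

End log_clip.

Section log_primitive.
Context (R : realType) (u : nat -> R) (K : R) (uK : forall n, `|u n| <= K).

(* The integral over [0, x] of t |-> u (floor (e^t) - 1), extended by 0 to
   negative [x]. *)
Definition log_primitive (x : R) : R :=
  \sum_(m < projT1 (cid (exists_ln_bound x))) u m * log_clip m x.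

Lemma log_primitiveE M x : x <= ln M.+1%:R ->
  log_primitive x = \sum_(m < M) u m * log_clip m x.
Proof.
have stable N N' : (N <= N')%N -> x <= ln N.+1%:R ->
    \sum_(m < N) u m * log_clip m x = \sum_(m < N') u m * log_clip m x.
  move=> NN xN; rewrite -!(big_mkord xpredT (fun m => u m * log_clip m x)).
  rewrite [RHS](big_cat_nat (leq0n _) NN)//= [X in _ + X](_ : _ = 0) ?addr0//.
  rewrite big_nat_cond big1// => m /andP[/andP[Nm _] _].
  by rewrite log_clip_left ?mulr0// (le_trans xN)// ln_nat_le.
move=> xM; rewrite /log_primitive; case: cid => N /= /ltW xN.
by have [MN|NM] := leqP N M; [exact: stable|rewrite (stable _ _ (ltnW NM))].
Qed.

Lemma log_primitive_lip x y : x <= y ->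
  `|log_primitive y - log_primitive x| <= K * (y - x).
Proof.
move=> xy; have [M /ltW yM] := exists_ln_bound y.
have xM := le_trans xy yM; have K0 := le_trans (normr_ge0 _) (uK 0).
rewrite (log_primitiveE yM) (log_primitiveE xM) -sumrB.
apply: le_trans (ler_norm_sum _ _ _) _.
apply: (@le_trans _ _ (\sum_(m < M) K * (log_clip m y - log_clip m x))).
  apply: ler_sum => m _; rewrite -mulrBr normrM.
  rewrite [`|log_clip _ _ - _|]ger0_norm ?subr_ge0 ?log_clip_mono//.
  by rewrite ler_wpM2r// subr_ge0 log_clip_mono.
rewrite -mulr_sumr sumrB !sum_log_clip// ler_wpM2l//.
by rewrite !maxEle; case: ifP => h1; case: ifP => h2; lra.
Qed.

(** In the dilated sequence u_m occupies [ln (2m + 1), ln (2m + 3)[, in the primitive translated by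
    ln 2 it occupies [ln (2m + 2), ln (2m + 4)[. What remains is the first piece of one minus the
    last piece of the other. *)
Lemma log_primitive_dilate M x : x <= ln M.+1%:R ->
  \sum_(k < M.*2) u (k %/ 2)%N * log_clip k x - log_primitive (x - ln 2) =
  \sum_(m < M) u m * (log_clip m.*2 x - log_clip m.+1.*2 x).
Proof.
move=> xM; have ln2 : 0 <= ln 2 :> R by rewrite ln_ge0// ler1n.
rewrite (@log_primitiveE M); last by rewrite (le_trans _ xM)// gerBl.
have -> : \sum_(k < M.*2) u (k %/ 2)%N * log_clip k x =
    \sum_(m < M) u m * (log_clip m.*2 x + log_clip m.*2.+1 x).
  elim: M {xM} => [|M IH]; first by rewrite !big_ord0.
  rewrite doubleS !big_ord_recr /= IH -addrA; congr (_ + _).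
  by rewrite !divn2 /= doubleK uphalf_double [RHS]mulrDr.
rewrite -sumrB; apply: eq_bigr => m _; rewrite -mulrBr; congr (_ * _).
have lnS k : ln k.+1.*2%:R = ln 2 + ln k.+1%:R :> R.
  by rewrite -mul2n natrM lnM// posrE.
rewrite /log_clip /clip -!doubleS.
have -> : x - ln 2 - ln m.+1%:R = x - ln m.*2.+2%:R by rewrite -doubleS lnS; ring.
have -> : x - ln 2 - ln m.+2%:R = x - ln m.*2.+4%:R by rewrite -!doubleS lnS; ring.
rewrite !doubleS; ring.
Qed.

End log_primitive.

(** Abel summation, which trades differences of interval lengths for increments of u, known to tend
    to 0. *)
Lemma sum_mul_diff (R : realType) (u V : nat -> R) M :
  \sum_(m < M.+1) u m * (V m - V m.+1) =
  u 0 * V 0 + \sum_(m < M) (u m.+1 - u m) * V m.+1 - u M * V M.+1.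
Proof.
elim: M => [|M IH]; first by rewrite big_ord_recr !big_ord0 /=; ring.
by rewrite big_ord_recr IH [X in _ = _ + X - _]big_ord_recr /=; ring.
Qed.

Section calL_limits.
Context (R : realType) (xi : linf R -> R[i]) (sxi : linf_state xi).
Context (xi_shift : forall j, (0 < j)%N -> xi \o shift_seq j = xi).
Implicit Types (a b : linf R).

Lemma shift_invariantE N a : xi (shift_seq N.+1 a) = xi a.
Proof. by rewrite -[RHS](congr1 (@^~ a) (xi_shift (ltn0Sn N))). Qed.

(** A shift by N + 1, positive as the invariance asks, brings the whole sequence between -e and e
    without changing the value of xi. *)
Lemma shift_invariant_null a : (forall n, a n = (complex.Re (a n))%:C) ->
  (forall e : R, 0 < e ->
    exists N, forall n, (N <= n)%N -> `|complex.Re (a n)| <= e) -> xi a = 0.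
Proof.
move=> aR a0; have [_ _ one] := sxi.
have xic (c : R) : xi (c%:C *: linf_one R) = c%:C by rewrite stateZ// one mulr1.
have key (e : R) : 0 < e -> (- e)%:C <= xi a <= e%:C.
  move=> e0; have [N aN] := a0 e e0.
  have aN' n : `|complex.Re (shift_seq N.+1 a n)| <= e.
    by apply: aN; rewrite (leq_trans (leqnSn N))// leq_addl.
  rewrite -(shift_invariantE N a) -(xic (- e)) -(xic e); apply/andP.
  split; apply: state_le => // n; rewrite !linfE mulr1 /= aR -real_complexB ler0c;
  by have := aN' n; rewrite ler_norml /= => /andP[]; lra.
(* Comparable elements of R[i] have equal imaginary parts. *)
have im0 : complex.Im (xi a) = 0.
  by have /andP[_] := key 1 ltr01; rewrite lecE /= => /andP[/eqP <-].
have re0 : complex.Re (xi a) = 0.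
  apply/normr0_eq0/le_anti; rewrite normr_ge0 andbT; apply/ler_addgt0Pr => e e0.
  have /andP[] := key e e0; rewrite !lecE /= => /andP[_ h1] /andP[_ h2].
  by rewrite add0r ler_norml h1.
by move: im0 re0; case: (xi a) => p q /= -> ->.
Qed.

Lemma calLE a M n : n.+1%:R < ln M.+1%:R :> R ->
  Linf (calL_subproof a) n =
  \sum_(m < M) a m * (log_clip m n.+1%:R - log_clip m n%:R)%:C.
Proof. exact: E_mapE. Qed.

Lemma calL_state : linf_state (calL xi).
Proof.
have [lin pos one] := sxi; split=> [c a b|a a0|].
- rewrite /calL -lin; congr xi; apply: linf_ext => n.
  have [M nM] := exists_ln_bound (n.+1%:R : R).
  rewrite linfDE linfZE !(calLE _ nM) mulr_sumr -big_split /=.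
  apply: eq_bigr => m _.
  rewrite -[LHS]/((c * a m + b m) * (log_clip m n.+1%:R - log_clip m n%:R)%:C).
  by rewrite mulrDl mulrA.
- apply: pos => n; have [M nM] := exists_ln_bound (n.+1%:R : R).
  rewrite (calLE _ nM) sumr_ge0// => m _; rewrite mulr_ge0// ler0c subr_ge0.
  by rewrite log_clip_mono// ler_nat.
- rewrite /calL -one; congr xi; apply: linf_ext => n.
  have [M nM] := exists_ln_bound (n.+1%:R : R).
  rewrite (calLE _ nM) linfE (eq_bigr (fun m : 'I_M =>
    (log_clip m n.+1%:R - log_clip m n%:R)%:C)); last by move=> m _; rewrite mul1r.
  rewrite -real_complex_sum sumrB !sum_log_clip ?(ltW nM)//.
    by rewrite !(elimT max_idPr)// -natrB// subSnn.
  by apply: ltW; apply: le_lt_trans nM; rewrite ler_nat.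
Qed.

(** A sequence supported below N yields a step function of t that vanishes past ln (N + 1), hence
    again a finitely supported sequence, and shift invariance kills it. *)
Lemma calL_generalised_limit : generalised_limit (calL xi).
Proof.
apply: state_generalised_limit calL_state _ => b N b0 bN.
have [N' NN'] : exists N', ln N.+1%:R <= N'%:R :> R.
  exists (Num.bound (ln N.+1%:R : R)).
  by apply/ltW/archi_boundP; exact: ln_nat_ge0.
have z n : (N' <= n)%N -> Linf (calL_subproof b) n = 0 :> R[i].
  move=> Nn; have [M nM] := exists_ln_bound (n.+1%:R : R).
  rewrite (calLE _ nM) big1// => m _; have [Nm|mN] := leqP N m.
    by rewrite bN// mul0r.
  have mn : ln m.+2%:R <= n%:R :> R.
    apply: (@le_trans _ _ (ln N.+1%:R)); first exact: ln_nat_le.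
    by apply: le_trans NN' _; rewrite ler_nat.
  rewrite !log_clip_right ?subrr ?mulr0//.
  by apply: le_trans mn _; rewrite ler_nat.
apply: shift_invariant_null => [n|e e0].
  apply: ge0_complexE; have [M nM] := exists_ln_bound (n.+1%:R : R).
  rewrite (calLE _ nM) sumr_ge0// => m _; rewrite mulr_ge0// ler0c subr_ge0.
  by rewrite log_clip_mono// ler_nat.
by exists N' => n Nn; rewrite z//= normr0 ltW.
Qed.

Lemma calL_dilate2 a : (forall n, a n = (complex.Re (a n))%:C) ->
  (forall e : R, 0 < e -> exists N, forall n, (N <= n)%N ->
     `|complex.Re (a n.+1) - complex.Re (a n)| <= e) ->
  calL xi (dilate_seq 2 a) = calL xi a.
Proof.
move=> aR a_slow; pose u n := complex.Re (a n).
have [K K0 aK] := linf_rnorm_bound a.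
have uK n : `|u n| <= K by apply: le_trans (aK n); exact: abs_Re_le.
pose Phi := log_primitive u.
(* The bound K ln 2 is the Lipschitz estimate for the primitive over a step of length ln 2. *)
have [|psi psiE] := @exists_linf R (fun n => (Phi n%:R - Phi (n%:R - ln 2))%:C) (K * ln 2).
  move=> n; rewrite rnorm_real.
  have ln2 : n%:R - ln 2 <= n%:R :> R by rewrite gerBl ln_ge0// ler1n.
  have := log_primitive_lip uK ln2.
  by have -> : n%:R - (n%:R - ln 2) = ln 2 :> R by ring.
have E1 n : Linf (calL_subproof a) n = (Phi n.+1%:R - Phi n%:R)%:C :> R[i].
  have [M nM] := exists_ln_bound (n.+1%:R : R).
  have nM' : n%:R <= ln M.+1%:R :> R.
    by apply: ltW; apply: le_lt_trans nM; rewrite ler_nat.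
  rewrite (calLE _ nM) /Phi (log_primitiveE _ (ltW nM)) (log_primitiveE _ nM').
  rewrite -sumrB real_complex_sum; apply: eq_bigr => m _.
  by rewrite aR -real_complexM -mulrBr.
(* The length of the part of [n, n + 1] on which e^t lies in [k + 1, k + 2[. *)
pose W k n := log_clip k n.+1%:R - log_clip k n%:R : R.
have W0 k n : 0 <= W k n by rewrite subr_ge0 log_clip_mono// ler_nat.
have E2 n M : n.+1%:R < ln M.+1%:R :> R ->
    Linf (calL_subproof (dilate_seq 2 a)) n - Linf (calL_subproof a) n
    + (psi n.+1 - psi n) =
    (u 0 * W 0 n + \sum_(m < M) (u m.+1 - u m) * W m.+1.*2 n)%:C :> R[i].
  move=> nM.
  have nM1 : n.+1%:R <= ln M.+2%:R :> R by rewrite (le_trans (ltW nM))// ln_nat_le.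
  have nM0 : n%:R <= ln M.+2%:R :> R by apply: le_trans nM1; rewrite ler_nat.
  have nM2 : n.+1%:R < ln M.+1.*2.+1%:R :> R.
    by apply: lt_le_trans nM _; apply: ln_nat_le; lia.
  rewrite E1 !psiE (calLE _ nM2).
  rewrite (eq_bigr (fun k : 'I_(M.+1.*2) => (u (k %/ 2)%N * W k n)%:C)); last first.
    by move=> k _; rewrite /= aR -real_complexM.
  rewrite -real_complex_sum -!real_complexB -real_complexD; congr (_%:C).
  have h1 := log_primitive_dilate u nM1; have h0 := log_primitive_dilate u nM0.
  have -> : \sum_(k < M.+1.*2) u (k %/ 2)%N * W k n =
      \sum_(k < M.+1.*2) u (k %/ 2)%N * log_clip k n.+1%:R -
      \sum_(k < M.+1.*2) u (k %/ 2)%N * log_clip k n%:R.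
    by rewrite -sumrB; apply: eq_bigr => k _; rewrite mulrBr.
  (* This piece starts beyond n + 1, so the boundary term of the Abel summation vanishes. *)
  have WM : W M.+1.*2 n = 0.
    rewrite /W !log_clip_left ?subrr//.
      by apply: le_trans nM0 _; apply: ln_nat_le; lia.
    by apply: le_trans nM1 _; apply: ln_nat_le; lia.
  have := sum_mul_diff u (fun m => W m.*2 n) M; rewrite WM mulr0 subr0 => <-.
  have -> : \sum_(m < M.+1) u m * (W m.*2 n - W m.+1.*2 n) =
      \sum_(m < M.+1) u m * (log_clip m.*2 n.+1%:R - log_clip m.+1.*2 n.+1%:R) -
      \sum_(m < M.+1) u m * (log_clip m.*2 n%:R - log_clip m.+1.*2 n%:R).
    by rewrite -sumrB; apply: eq_bigr => m _; rewrite /W; ring.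
  rewrite -h1 -h0 /Phi; ring.
have null : xi (Linf (calL_subproof (dilate_seq 2 a)) - Linf (calL_subproof a)
    + (shift_seq 1 psi - psi)) = 0.
  apply: shift_invariant_null => [n|e e0].
    have [M nM] := exists_ln_bound (n.+1%:R : R).
    by have := E2 n M nM; rewrite !linfE /= addn1 => -> /=.
  have [N uN] := a_slow e e0.
  (* From N' on, all pieces of index up to 2N + 2 lie to the left of n: only increments of u at
     indices m >= N survive, each at most e. *)
  have [N' NN'] : exists N', ln N.+1.*2.+2%:R <= N'%:R :> R.
    exists (Num.bound (ln N.+1.*2.+2%:R : R)).
    by apply/ltW/archi_boundP; exact: ln_nat_ge0.
  exists N' => n Nn; have [M nM] := exists_ln_bound (n.+1%:R : R).
  have := E2 n M nM; rewrite !linfE /= addn1 => -> /=.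
  have Wz k : (k <= N.+1.*2)%N -> W k n = 0.
    move=> kN; have kn : ln k.+2%:R <= n%:R :> R.
      apply: (@le_trans _ _ (ln N.+1.*2.+2%:R)); first exact: ln_nat_le.
      by apply: le_trans NN' _; rewrite ler_nat.
    rewrite /W !log_clip_right ?subrr//.
    by apply: le_trans kn _; rewrite ler_nat.
  rewrite Wz// mulr0 add0r; apply: le_trans (ler_norm_sum _ _ _) _.
  apply: (@le_trans _ _ (e * \sum_(m < M) W m.+1.*2 n)).
    rewrite mulr_sumr; apply: ler_sum => m _; rewrite normrM (ger0_norm (W0 _ _)).
    have [Nm|mN] := leqP N m; first by rewrite ler_wpM2r// uN.
    by rewrite Wz ?mulr0//; lia.
  rewrite -[leRHS]mulr1 ler_wpM2l ?(ltW e0)//.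
  (* The even pieces are part of a partition of [n, n + 1], whose total length is 1. *)
  have W2 : \sum_(m < M) W m.+1.*2 n <= \sum_(k < M.+1.*2) W k n.
    have : 0 <= W 0%N n by [].
    have -> : \sum_(k < M.+1.*2) W k n =
        W 0%N n + \sum_(m < M) (W m.*2.+1 n + W m.+1.*2 n) + W M.*2.+1 n.
      elim: (M) => [|k IH]; first by rewrite !big_ord_recr !big_ord0 /=; ring.
      by rewrite doubleS 2!big_ord_recr /= IH big_ord_recr /= ?doubleS; ring.
    have : \sum_(m < M) W m.+1.*2 n <= \sum_(m < M) (W m.*2.+1 n + W m.+1.*2 n).
      by apply: ler_sum => m _; rewrite lerDr.
    by have := W0 M.*2.+1 n; lra.
  apply: (le_trans W2); rewrite sumrB.
  have nM1 : n.+1%:R <= ln M.+1.*2.+1%:R :> R.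
    by apply: le_trans (ltW nM) _; apply: ln_nat_le; lia.
  have nM0 : n%:R <= ln M.+1.*2.+1%:R :> R by apply: le_trans nM1; rewrite ler_nat.
  rewrite !sum_log_clip// !(elimT max_idPr)// -natrB// subSnn//.
move: null; rewrite stateD// !stateB// shift_invariantE subrr addr0 => /eqP.
by rewrite subr_eq0 => /eqP.
Qed.

End calL_limits.

Section DL2_membership.
Context (R : realType) (H : hilbertType R).

(** Multiplied by ln (n + 3), the increment becomes the new singular value minus gamma_n (ln (n + 3)
    - ln (n + 2)), which stays bounded by C + K ln 2. *)
Lemma gamma_seq_slow (S : bop H) : weakL1 S -> forall e : R, 0 < e ->
  exists N, forall n, (N <= n)%N -> `|gamma_seq S n.+1 - gamma_seq S n| <= e.
Proof.
move=> [_ [K0 SK]] e e0; pose K := Num.max 0 K0; pose C := singular_value S 0.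
have K_ge0 : 0 <= K by rewrite le_max lexx.
have C_ge0 : 0 <= C by exact: singular_value_ge0.
have gK n : 0 <= gamma_seq S n <= K.
  rewrite le_max SK ?orbT; last by exists n.
  rewrite andbT mulr_ge0 ?invr_ge0 ?ln_ge0 ?ler1n// sumr_ge0// => j _.
  exact: singular_value_ge0.
pose X := expR ((C + K * ln 2) / e); exists (Num.bound X) => n Xn.
have X0 : 0 < X by exact: expR_gt0.
have nX : X <= n.+3%:R.
  apply: le_trans (ltW (archi_boundP (ltW X0))) _.
  by rewrite ler_nat (leq_trans Xn)// -addn3 leq_addr.
have lX : C + K * ln 2 <= e * ln n.+3%:R.
  by rewrite -ler_pdivrMl// mulrC -[leLHS]expRK ler_ln ?posrE.
have ln2p : 0 < ln n.+2%:R :> R by rewrite ln_gt0// ltr1n.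
have ln3p : 0 < ln n.+3%:R :> R by rewrite ln_gt0// ltr1n.
have ln23 : ln n.+2%:R <= ln n.+3%:R :> R by rewrite ler_ln ?posrE// ler_nat.
have ln32 : ln n.+3%:R <= ln n.+2%:R + ln 2 :> R.
  rewrite -lnM ?posrE// ler_ln ?posrE ?mulr_gt0// -natrM ler_nat; lia.
have mu0 : 0 <= singular_value S n.+1 by exact: singular_value_ge0.
have muC : singular_value S n.+1 <= C by exact: singular_value_anti.
have gE : (gamma_seq S n.+1 - gamma_seq S n) * ln n.+3%:R =
    singular_value S n.+1 - gamma_seq S n * (ln n.+3%:R - ln n.+2%:R).
  rewrite /gamma_seq big_ord_recr /=; field.
  by rewrite !gt_eqF.
rewrite -(ler_pM2r ln3p); apply: le_trans lX.
rewrite -[X in _ * X](gtr0_norm ln3p) -normrM gE.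
have /andP[g0 gK'] := gK n.
have h1 : gamma_seq S n * (ln n.+3%:R - ln n.+2%:R) <= K * ln 2.
  by apply: ler_pM => //; lra.
have h2 : 0 <= gamma_seq S n * (ln n.+3%:R - ln n.+2%:R).
  by rewrite mulr_ge0// subr_ge0.
by rewrite ler_norml; apply/andP; split; lra.
Qed.

Lemma calL_DL2 (xi : linf R -> R[i]) : BL xi -> DL2 H (calL xi).
Proof.
move=> [sxi xi_shift]; split; first exact: calL_generalised_limit.
move=> S wS _; apply: calL_dilate2 => // e e0.
exact: gamma_seq_slow.
Qed.

End DL2_membership.

Theorem theorem3p7 (R : realType) (H : hilbertType R)
  (sepH : separable_space H)
  (T : bop H) (posT : positive_op T) (weakT : weakL1 T)
  (TrT_gt0 : forall w, DL2 H w -> 0 < Tr w T)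
  (w : linf R -> R[i]) (w_calL : (@calL R @` (@BL R `&` @DL R)) w)
  (h : nat -> H) (orth_h : orthonormal_system h) (compl_h : complete_system h)
  (eig_h : forall m, eigenvector T (h m)) :
  exists L : linf R -> R[i], generalised_limit L /\
    forall A : bop H, phi_Tr w T A = L (diagonal_seq orth_h A).
Proof.
have wDL2 : DL2 H w by case: w_calL => xi [BLxi _] <-; exact: calL_DL2.
have Tr_gt0 := TrT_gt0 w wDL2.
(* Without a linear extension, [Tr w] would be the default value of [xget],
   which vanishes at [T]. *)
have Tr_ext : linear_extension (H := H) w (Tr w).
  have [ex|noext] := pselect (exists tau : bop H -> R[i], linear_extension w tau).
    exact: xgetPex ex.
  have Tr0 : Tr w = (fun=> 0) :> (bop H -> R[i]).
    by apply: xgetPN => tau tau_ext; apply: noext; exists tau.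
  by move: Tr_gt0; rewrite Tr0 ltxx.
exact: (diagonal_generalised_limit orth_h compl_h posT weakT eig_h wDL2.1 Tr_ext).
Qed.
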